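(* Let $(A,\phi_0)$ be a Jacobi algebroid over $M$, with $A$ and $M$ orientable, and let $\hat A=A\times\mathbb R\to M\times\mathbb R$ be the Lie algebroid induced from $A$ by $\phi_0$. Then, as cohomology classes in the Lie algebroid cohomology $H^1(\hat A)$, $$[\xi_{\hat A}]=[\xi_A^{\phi_0}]=[\xi_A],$$ where $\xi_{\hat A}$ is a modular form of the Lie algebroid $\hat A$, $\xi_A^{\phi_0}$ is a modular form of the Jacobi algebroid $(A,\phi_0)$, $\xi_A$ is a modular form of the Lie algebroid $A$, and sections of $A^*$ are regarded as time-independent sections of $\hat A^*$.
   Context: A Jacobi algebroid $(A,\phi_0)$ is a Lie algebroid $(A,[\cdot,\cdot],\rho)$ over $M$ with a 1-cocycle $\phi_0\in\Gamma(A^* )$ ($\mathrm d\phi_0=0$). The Lie algebroid structure on $\hat A=A\times\mathbb R\to M\times\mathbb R$ induced from $A$ by $\phi_0$ is determined on time-independent sections $X,Y\in\Gamma(A)$ (which generate $\Gamma(\hat A)$ over $C^\infty(M\times\mathbb R)$) by $[X,Y]_{\hat A}=[X,Y]$ and $\hat\rho(X)=\rho(X)+\langle\phi_0,X\rangle\frac{\partial}{\partial t}$. For a Lie algebroid $(B,[\cdot,\cdot],\rho_B)$ over $S$ with non-vanishing sections $\eta\in\Gamma(\wedge^{\mathrm{top}}B)$ and $\mu\in\Omega^{\mathrm{top}}(S)$, the modular form $\xi_B^{\eta\otimes\mu}\in\Gamma(B^* )$ is defined by $\langle\xi_B^{\eta\otimes\mu},X\rangle\,\eta\otimes\mu=[X,\eta]\otimes\mu+\eta\otimes\mathcal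 L_{\rho_B(X)}\mu$ for $X\in\Gamma(B)$ (with $[X,\eta]$ the Schouten bracket, i.e. the Lie derivative of $\eta$). It is a 1-cocycle whose class in $H^1(B)$ does not depend on $\eta,\mu$. For a Jacobi algebroid $(A,\phi_0)$ of rank $n$, the modular form with respect to $\eta\otimes\mu$ is $\xi_A^{\phi_0,\eta\otimes\mu}=\xi_A^{\eta\otimes\mu}-(n-1)\phi_0$. *)

(* Defs.v *)
(* Smooth manifolds, smooth vector bundles, Lie algebroids and their modular
   forms over the reals.  Structures come as a record of raw data together with
   a predicate stating the axioms. *)
From HB Require Import structures.
From mathcomp Require Import all_boot all_order all_algebra.
From mathcomp Require Import all_classical all_reals all_analysis.
Set Implicit Arguments.
Unset Strict Implicit.
Unset Printing Implicit Defensive.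
Import Order.TTheory GRing.Theory Num.Theory.
Import numFieldNormedType.Exports.
Local Open Scope classical_set_scope.
Local Open Scope ring_scope.

(* [D] is always an open set below. *)
Fixpoint Ck (R : realType) (m k : nat) (D : set 'rV[R]_m) (f : 'rV[R]_m -> R)
    : Prop :=
  if k is k'.+1 then
    (forall a, D a -> differentiable f a) /\
    (forall i : 'I_m, Ck k' D (fun a => 'D_(delta_mx 0 i) f a))
  else forall a, D a -> {for a, continuous f}.

Definition Cinf (R : realType) (m : nat) (D : set 'rV[R]_m) (f : 'rV[R]_m -> R)
  : Prop := forall k, Ck k D f.

(** Manifolds *)

(* The atlas is indexed by the points of the space: [cmap x], with inverse
   [cinv x], is a chart defined on the neighbourhood [cdom x] of [x].  Any smooth
   structure is presented by such an atlas (choose one chart around each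
   point). *)
Record charted (R : realType) (m : nat) := Charted {
  pts :> topologicalType ;
  cdom : pts -> set pts ;
  cmap : pts -> pts -> 'rV[R]_m ;
  cinv : pts -> 'rV[R]_m -> pts }.

Definition is_manifold (R : realType) (m : nat) (M : charted R m) : Prop :=
  [/\ hausdorff_space M, @second_countable M,
      forall x : M, [/\ open (cdom x), cdom x x &
        open (cmap x @` cdom x)] /\
        [/\ {in cdom x, cancel (cmap x) (cinv x)},
        {within cdom x, continuous (cmap x)} &
        {within cmap x @` cdom x, continuous (cinv x)}] &
      forall (x y : M) (j : 'I_m),
        Cinf (cmap x @` (cdom x `&` cdom y))
             (fun a => cmap y (cinv x a) 0 j)].

Definition smooth_on (R : realType) (m : nat) (M : charted R m) (U : set M)
    (f : M -> R) : Prop :=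
  forall x : M, Cinf (cmap x @` (U `&` cdom x)) (f \o cinv x).

(* The tangent space at [x] is ['rV_m], a tangent vector being given by its
   components in the chart [cmap x]; [dirder x v f] is the derivative of [f]
   along the tangent vector [v] at [x]. *)
Definition dirder (R : realType) (m : nat) (M : charted R m) (x : M)
    (v : 'rV[R]_m) (f : M -> R) : R :=
  'D_v (f \o cinv x) (cmap x x).

(** Vector bundles *)

(* A family of vector spaces with a family of local frames: [frame i] is a frame
   over [fdom i]. *)
Record vbundle (R : realType) (m : nat) (M : charted R m) (n : nat) := VBundle {
  fib :> M -> vectType R ;
  fidx : Type ;
  fdom : fidx -> set M ;
  frame : fidx -> 'I_n -> forall x, fib x }.

Definition section (R : realType) (m : nat) (M : charted R m) (n : nat)
  (E : vbundle M n) := forall x, E x.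

Definition smooth_section_on (R : realType) (m : nat) (M : charted R m)
    (n : nat) (E : vbundle M n) (U : set M) (s : section E) : Prop :=
  forall i : fidx E, exists c : 'I_n -> M -> R,
    (forall k, smooth_on (U `&` fdom i) (c k)) /\
    (forall x, (U `&` fdom i) x -> s x = \sum_k c k x *: frame i k x).

Definition smooth_section (R : realType) (m : nat) (M : charted R m)
    (n : nat) (E : vbundle M n) (s : section E) : Prop :=
  smooth_section_on setT s.

Definition is_vbundle (R : realType) (m : nat) (M : charted R m)
    (n : nat) (E : vbundle M n) : Prop :=
  [/\ forall i : fidx E, open (fdom i),
      forall x, exists i : fidx E, fdom i x,
      forall (i : fidx E) x, fdom i x ->
        basis_of fullv [tuple frame i k x | k < n] &
      forall (i : fidx E) k, smooth_section_on (fdom i) (frame i k)].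

(* Frames: the coordinate vector fields d/dx_i of each chart. *)
Definition tangent (R : realType) (m : nat) (M : charted R m) : vbundle M m :=
  @VBundle R m M m (fun _ => 'rV[R]_m) M (@cdom R m M)
    (fun x i y => \row_j
       'D_(delta_mx 0 i) (fun a => cmap y (cinv x a) 0 j) (cmap x y)).

(* Frames: the dual bases of the frames of [E]. *)
Definition dual_bundle (R : realType) (m : nat) (M : charted R m) (n : nat)
    (E : vbundle M n) : vbundle M n :=
  @VBundle R m M n (fun x => 'Hom(E x, R^o)) (fidx E) (@fdom R m M n E)
    (fun i k x => linfun (coord [tuple frame i l x | l < n] k)).

(* Existence of an atlas of frames with positive transition determinants. *)
Definition orientable (R : realType) (m : nat) (M : charted R m) (n : nat)
    (E : vbundle M n) : Prop :=
  exists (J : Type) (U : J -> set M) (e : J -> 'I_n -> section E),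
  [/\ forall j, open (U j) /\ (forall k, smooth_section_on (U j) (e j k)),
      forall x, exists j, U j x,
      forall j x, U j x -> basis_of fullv [tuple e j k x | k < n] &
      forall i j x (P : 'M[R]_n), U i x -> U j x ->
        (forall k, e j k x = \sum_l P k l *: e i l x) -> 0 < \det P].

Definition vbracket (R : realType) (m : nat) (M : charted R m)
    (V W : section (tangent M)) : section (tangent M) :=
  fun x => \row_i
    (dirder x (V x) (fun y => dirder y (W y) (fun z => cmap x z 0 i))
   - dirder x (W x) (fun y => dirder y (V y) (fun z => cmap x z 0 i))).

(** Sections of top exterior powers *)

(* A section of the top exterior power of [E^*] is a field of alternating
   [n]-linear forms on the fibers of the rank [n] bundle [E].  Top forms on M are
   obtained for [tangent M], and sections of the top exterior power of [E] itself
   for [dual_bundle E], since E = E^**. *)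
Definition top_form (R : realType) (m : nat) (M : charted R m) (n : nat)
  (E : vbundle M n) := forall x, ('I_n -> E x) -> R.

Definition alternating (R : realType) (V : vectType R) (n : nat)
    (w : ('I_n -> V) -> R) : Prop :=
  (forall (v : 'I_n -> V) i (a : R) (u u' : V),
     w [eta v with i |-> a *: u + u'] =
     a * w [eta v with i |-> u] + w [eta v with i |-> u']) /\
  (forall (v : 'I_n -> V) i j, i != j -> v i = v j -> w v = 0).

Definition smooth_top_form (R : realType) (m : nat) (M : charted R m) (n : nat)
    (E : vbundle M n) (w : top_form E) : Prop :=
  (forall x, alternating (w x)) /\
  (forall i : fidx E, smooth_on (fdom i) (fun x => w x (fun k => frame i k x))).

Definition nonvanishing (R : realType) (m : nat) (M : charted R m) (n : nat)
    (E : vbundle M n) (w : top_form E) : Prop :=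
  forall x, exists v, w x v != 0.

(* The value on [s] of the Lie derivative of [w], where [V] is the vector field
   giving the Lie derivative of functions and [delta] the Lie derivative of
   sections of [E]:
     (L w)(s_1,..,s_n) = V(w(s_1,..,s_n)) - sum_i w(s_1,..,delta s_i,..,s_n). *)
Definition lie_top (R : realType) (m : nat) (M : charted R m) (n : nat)
    (E : vbundle M n) (V : section (tangent M)) (delta : section E -> section E)
    (w : top_form E) (s : 'I_n -> section E) (x : M) : R :=
  dirder x (V x) (fun y => w y (fun k => s k y))
  - \sum_i w x [eta (fun k => s k x) with i |-> delta (s i) x].

(** Lie algebroids *)

(* [bracket] is only meaningful on smooth sections. *)
Record algebroid (R : realType) (m : nat) (M : charted R m) (n : nat)
    (B : vbundle M n) := Algebroid {
  anchor : forall x, 'Hom(B x, tangent M x) ;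
  bracket : section B -> section B -> section B }.

Definition rho (R : realType) (m : nat) (M : charted R m) (n : nat)
    (B : vbundle M n) (L : algebroid B) (X : section B) : section (tangent M) :=
  fun x => anchor L x (X x).

Definition is_lie_algebroid (R : realType) (m : nat) (M : charted R m) (n : nat)
    (B : vbundle M n) (L : algebroid B) : Prop :=
  (forall X, smooth_section X -> smooth_section (rho L X)) /\
  (forall X Y, smooth_section X -> smooth_section Y ->
     smooth_section (bracket L X Y)) /\
  (forall (a : R) X Y Z,
     smooth_section X -> smooth_section Y -> smooth_section Z ->
     bracket L (fun x => a *: X x + Y x) Z =
     fun x => a *: bracket L X Z x + bracket L Y Z x) /\
  (forall X Y, smooth_section X -> smooth_section Y ->
     bracket L X Y = fun x => - bracket L Y X x) /\
  (forall X Y Z, smooth_section X -> smooth_section Y -> smooth_section Z ->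
     forall x, bracket L X (bracket L Y Z) x + bracket L Y (bracket L Z X) x
               + bracket L Z (bracket L X Y) x = 0) /\
  (forall X Y f, smooth_section X -> smooth_section Y -> smooth_on setT f ->
     bracket L X (fun x => f x *: Y x) =
     fun x => f x *: bracket L X Y x + dirder x (rho L X x) f *: Y x) /\
  (forall X Y, smooth_section X -> smooth_section Y ->
     rho L (bracket L X Y) = vbracket (rho L X) (rho L Y)).

(* d alpha = 0, for a 1-form alpha *)
Definition closed1 (R : realType) (m : nat) (M : charted R m) (n : nat)
    (B : vbundle M n) (L : algebroid B) (alpha : section (dual_bundle B)) : Prop :=
  forall X Y : section B, smooth_section X -> smooth_section Y -> forall x,
    dirder x (rho L X x) (fun y => alpha y (Y y))
    - dirder x (rho L Y x) (fun y => alpha y (X y))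
    - alpha x (bracket L X Y x) = 0.

Definition cocycle1 (R : realType) (m : nat) (M : charted R m) (n : nat)
    (B : vbundle M n) (L : algebroid B) (alpha : section (dual_bundle B)) : Prop :=
  smooth_section alpha /\ closed1 L alpha.

(* alpha and beta define the same class in the first Lie algebroid cohomology
   space: both are 1-cocycles and alpha - beta = df for a smooth function f,
   where <df, v> = rho(v)(f). *)
Definition same_H1_class (R : realType) (m : nat) (M : charted R m) (n : nat)
    (B : vbundle M n) (L : algebroid B) (alpha beta : section (dual_bundle B)) : Prop :=
  [/\ cocycle1 L alpha, cocycle1 L beta &
      exists f : M -> R, smooth_on setT f /\
        forall x (v : B x), alpha x v - beta x v = dirder x (anchor L x v) f].

(* (L_X alpha)_x is the covector beta with
     <beta, Y_x> = rho(X)<alpha, Y> (x) - <alpha, [X, Y]> (x)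
   for all sections Y; for smooth X and alpha it exists and is unique, the right
   hand side being function-linear in Y. *)
Definition lie_covector (R : realType) (m : nat) (M : charted R m) (n : nat)
    (B : vbundle M n) (L : algebroid B) (X : section B)
    (alpha : section (dual_bundle B)) : section (dual_bundle B) :=
  fun x => xget 0 [set beta : dual_bundle B x |
    forall Y : section B, smooth_section Y ->
      beta (Y x) = dirder x (rho L X x) (fun y => alpha y (Y y))
                   - alpha x (bracket L X Y x)].

(* <xi, X> eta (x) mu = [X, eta] (x) mu + eta (x) L_{rho(X)} mu, an identity
   between sections of a tensor product of line bundles, evaluated on arbitrary
   sections [al] of B^* and vector fields [V]. *)
Definition is_modular_form (R : realType) (m : nat) (M : charted R m) (n : nat)
    (B : vbundle M n) (L : algebroid B)
    (eta : top_form (dual_bundle B)) (mu : top_form (tangent M))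
    (xi : section (dual_bundle B)) : Prop :=
  smooth_section xi /\
  forall X : section B, smooth_section X ->
  forall (al : 'I_n -> section (dual_bundle B)) (V : 'I_m -> section (tangent M)),
  (forall i, smooth_section (al i)) -> (forall j, smooth_section (V j)) ->
  forall x,
    xi x (X x) * (eta x (fun i => al i x) * mu x (fun j => V j x)) =
    lie_top (rho L X) (lie_covector L X) eta al x * mu x (fun j => V j x)
    + eta x (fun i => al i x) * lie_top (rho L X) (vbracket (rho L X)) mu V x.

(** Jacobi algebroids *)

Definition is_jacobi_algebroid (R : realType) (m : nat) (M : charted R m)
    (n : nat) (A : vbundle M n) (L : algebroid A) (phi0 : section (dual_bundle A))
    : Prop :=
  is_lie_algebroid L /\ cocycle1 L phi0.

Definition is_jacobi_modular_form (R : realType) (m : nat) (M : charted R m)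
    (n : nat) (A : vbundle M n) (L : algebroid A) (phi0 : section (dual_bundle A))
    (eta : top_form (dual_bundle A)) (mu : top_form (tangent M))
    (xi0 : section (dual_bundle A)) : Prop :=
  exists xi : section (dual_bundle A), is_modular_form L eta mu xi /\
    xi0 = fun x => xi x - (n%:R - 1) *: phi0 x.

(* The product manifold M x R; the last coordinate is the time t. *)
Definition cylinder (R : realType) (m : nat) (M : charted R m)
    : charted R (m + 1) :=
  @Charted R (m + 1) (M * R)%type
    (fun p => cdom p.1 `*` setT)
    (fun p q => row_mx (cmap p.1 q.1) q.2%:M)
    (fun p a => (cinv p.1 (lsubmx a), rsubmx a 0 0)).

(* The bundle A x R over M x R. *)
Definition hat (R : realType) (m : nat) (M : charted R m) (n : nat)
    (A : vbundle M n) : vbundle (cylinder M) n :=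
  @VBundle R (m + 1) (cylinder M) n (fun p => A p.1) (fidx A)
    (fun i => fdom i `*` setT) (fun i k p => frame i k p.1).

Definition time_indep (R : realType) (m : nat) (M : charted R m) (n : nat)
    (A : vbundle M n) (X : section A) : section (hat A) :=
  fun p => X p.1.

Definition time_indep_dual (R : realType) (m : nat) (M : charted R m) (n : nat)
    (A : vbundle M n) (xi : section (dual_bundle A)) : section (dual_bundle (hat A)) :=
  fun p => xi p.1.

(* [row_mx v 0] is the tangent vector v of M at x, seen at (x, t), and
   [row_mx 0 1] is d/dt; [row_mx v a%:M] is thus v + a d/dt. *)
Definition is_induced_algebroid (R : realType) (m : nat) (M : charted R m)
    (n : nat) (A : vbundle M n) (L : algebroid A) (phi0 : section (dual_bundle A))
    (Lhat : algebroid (hat A)) : Prop :=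
  [/\ is_lie_algebroid Lhat,
      forall X Y : section A, smooth_section X -> smooth_section Y ->
        bracket Lhat (time_indep X) (time_indep Y) =
        time_indep (bracket L X Y) &
      forall X : section A, smooth_section X ->
        rho Lhat (time_indep X) =
        fun p => row_mx (rho L X p.1) (phi0 p.1 (X p.1))%:M].

(* Main.v *)
(* If [etaH = g eta] and [muH = k mu /\ dt] for functions [g], [k] on the
   cylinder, then comparing the defining identities of the modular forms on
   time-independent sections gives xi_hat = xi_A + d ln |g k|.  This uses that the
   bracket of the lift of rho(X) with d/dt vanishes, and that its bracket with the
   lift of a vector field has a d/dt component which does not contribute to
   [muH].  Since phi0 = d t, the multiple (n - 1) phi0 is exact on the cylinder.

   That xi_hat is closed follows by applying [L_X] to the identity defining
   <xi, Y> and antisymmetrizing; a form which differs from a closed form by an exact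
   one is closed, so the two time-independent forms need no separate argument.
   As modular forms are characterized by global sections only, bump functions are
   needed to find sections with prescribed values at a point. *)
Require Import Defs.
From HB Require Import structures.
From mathcomp Require Import all_boot all_order all_algebra.
From mathcomp Require Import fingroup perm.
From mathcomp Require Import all_classical all_reals all_analysis.
From mathcomp Require Import ring.
Import Order.TTheory GRing.Theory Num.Theory.
Import numFieldNormedType.Exports.
Local Open Scope classical_set_scope.
Local Open Scope ring_scope.
Set Implicit Arguments.
Unset Strict Implicit.
Unset Printing Implicit Defensive.

(** * Calculus on row vectors *)

(** A tangent vector at [x] is stored by its components in the chart attached to [x]. This chart
    jumps with the base point, so the components of a smooth vector field need not be smooth
    functions. Vector fields are therefore handled through their action on functions: smoothness and
    identities, among them the Jacobi identity, are tested on the coordinates of one fixed chart.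

    The other obstacle is that [lie_covector] is obtained by choice. Its characteristic formula is
    available only once the right-hand side is known to depend on the value of [Y] at the point
    alone, and this again rests on bump functions.

    Time-independent sections suffice for the comparison because every vector in a fibre of [hat A]
    is the value of one. The factors [g] and [k] may depend on time, and they are differentiated
    along the whole anchor, including its d/dt part. The primitive of the difference therefore lives
    on the cylinder, and the equality of classes holds in the cohomology of [hat A]. *)

Section NearDifferentiable.
Context {R : numFieldType} {V W : normedModType R}.

(** The difference vanishes near [a], so the zero map is its differential, with zero remainder
    there. Chart identities that hold only on a neighbourhood can thus be used under
    [differentiable]. *)
Lemma near_eq_differentiable (f g : V -> W) (a : V) :
  (\forall b \near a, f b = g b) -> differentiable f a -> differentiable g a.
Proof.
move=> fg df.
suff dz : differentiable (g - f) a.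
  by rewrite -[g](subrK f); exact: differentiableD.
set z := g - f.
have nz : \forall b \near a, z b = 0.
  by near=> b; rewrite /z /= !fctE (_ : f b = g b) ?subrr//; near: b.
have z0 : z a = 0 by exact: nbhs_singleton nz.
have E : z \o shift a = cst (z a) + (\0 : V -> W) +o_ 0 id.
  apply/eqaddoP => e e0; near=> h.
  rewrite /= !fctE /= z0 (_ : z (h + a) = 0) ?addr0 ?subrr ?normr0 ?mulr_ge0 ?(ltW e0)//.
  near: h; have := nz; rewrite (near_shift 0 a) /=.
  by apply: filterS => h; rewrite /= subr0.
apply/diff_locallyP.
have -> : 'd z a = \0 :> (V -> W).
  by apply: (@diff_unique _ _ _ z (\0 : {linear V -> W}) a); [exact: cst_continuous|exact: E].
by split; [exact: cst_continuous|exact: E].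
Unshelve. all: by end_near. Qed.

End NearDifferentiable.

Lemma derive_compR (R : realType) (V : normedModType R) (phi : R -> R)
    (f : V -> R) (a v : V) :
  differentiable f a -> differentiable phi (f a) ->
  'D_v (phi \o f) a = 'D_1 phi (f a) * 'D_v f a.
Proof.
move=> df dp; rewrite deriveE; last exact: differentiable_comp.
by rewrite diff_comp//= diff1E// derive1E -[in LHS]deriveE// [LHS]mulrC.
Qed.

Section RowDerivative.
Context {R : realType} {m : nat}.
Implicit Types (f : 'rV[R]_m -> R) (a v : 'rV[R]_m).

Lemma derive_rowE f a v : differentiable f a ->
  'D_v f a = \sum_i v 0 i * 'D_(delta_mx 0 i) f a.
Proof.
move=> df; rewrite deriveE// [in LHS](row_sum_delta v) linear_sum.
by apply: eq_bigr => i _; rewrite linearZ deriveE.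
Qed.

Lemma derive_addr f a u v : differentiable f a ->
  'D_(u + v) f a = 'D_u f a + 'D_v f a.
Proof. by move=> df; rewrite !deriveE// linearD. Qed.

Lemma derive_scaler f a k v : differentiable f a ->
  'D_(k *: v) f a = k * 'D_v f a.
Proof. by move=> df; rewrite !deriveE// linearZ. Qed.

Lemma differentiable_row {V : normedModType R} (G : V -> 'rV[R]_m) x :
  (forall j, differentiable (fun y => G y 0 j) x) -> differentiable G x.
Proof.
move=> dG; rewrite (_ : G = \sum_(j < m) (fun y => G y 0 j *: delta_mx 0 j)).
  by apply: differentiable_sum => j; apply: differentiableZl.
by apply/funext => y; rewrite fct_sumE {1}(row_sum_delta (G y)).
Qed.

Lemma derive_comp_row {V : normedModType R} (f : 'rV[R]_m -> R)
    (G : V -> 'rV[R]_m) (x w : V) :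
  differentiable f (G x) -> (forall j, differentiable (fun y => G y 0 j) x) ->
  'D_w (f \o G) x = \sum_j 'D_w (fun y => G y 0 j) x * 'D_(delta_mx 0 j) f (G x).
Proof.
move=> df dG; have dGx := differentiable_row dG.
rewrite deriveE; last exact: differentiable_comp.
rewrite diff_comp//= -deriveE// derive_rowE//; apply: eq_bigr => j _.
rewrite -deriveE// derive_mx; first by rewrite mxE.
exact: diff_derivable.
Qed.

End RowDerivative.

Lemma ltr_distD2 (R : realFieldType) (x y z e : R) :
  `|x - z| < e -> `|y - z| < e -> `|x - y| < e + e.
Proof.
move=> xz yz; rewrite -(subrK z x) -addrA (le_lt_trans (ler_normD _ _))//.
by rewrite ltrD// distrC.
Qed.

(** * Symmetry of mixed second derivatives *)

Section MixedPartials.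
Context {R : realType} {m : nat}.
Implicit Types (f : 'rV[R]_m -> R) (a u v p : 'rV[R]_m).

Lemma differentiable_addr (w b : 'rV[R]_m) :
  differentiable (fun c => c + w) b.
Proof.
have := @differentiableD _ 'rV[R]_m 'rV[R]_m id (cst w) b; apply.
  by have [] := is_diff_id b.
exact: differentiable_cst.
Qed.

Lemma derive_shiftr f (a u w : 'rV[R]_m) :
  'D_u (fun b => f (b + w)) a = 'D_u f (a + w).
Proof.
rewrite /derive; set d := (fun _ : R => _); set d' := (fun _ : R => _).
by suff -> : d = d' by []; apply/funext => h; rewrite /d /d' /= addrA.
Qed.

Lemma is_derive_line f p v (t : R) : differentiable f (p + t *: v) ->
  is_derive t 1 (fun s : R => f (p + s *: v)) ('D_v f (p + t *: v)).
Proof.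
move=> /diff_derivable - /(_ v) df.
suff E : (fun h : R => h^-1 *: (((fun s : R => f (p + s *: v)) \o shift t) (h *: 1)
      - f (p + t *: v))) =
    (fun h => h^-1 *: ((f \o shift (p + t *: v)) (h *: v) - f (p + t *: v))).
  by apply: DeriveDef; rewrite /derivable /derive E.
apply/funext => h /=; congr (_ *: (f _ - _)).
by rewrite [h%:A]mulr1 scalerDl addrCA.
Qed.

Lemma MVT_line f p v (h : R) : 0 < h ->
  (forall t, 0 <= t <= h -> differentiable f (p + t *: v)) ->
  exists2 t, 0 <= t <= h & f (p + h *: v) - f p = h * 'D_v f (p + t *: v).
Proof.
move=> h0 df.
have [|||t] := @MVT_segment R (fun s : R => f (p + s *: v))
    (fun t => 'D_v f (p + t *: v)) 0 h.
- exact: ltW.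
- move=> t; rewrite in_itv/= => /andP[t0 th]; apply: is_derive_line.
  by apply: df; rewrite !ltW.
- apply: derivable_within_continuous => t; rewrite in_itv/= => th.
  by have [] := is_derive_line (df t th).
rewrite in_itv/= => th; rewrite scale0r addr0 subr0 => e.
by exists t => //; rewrite e mulrC.
Qed.

(* The second difference of [f] is [h ^ 2] times a mixed derivative at a nearby
   point; by symmetry in [u] and [v], the two mixed derivatives agree at [a]. *)
Lemma second_difference (D : set 'rV[R]_m) f a u v (h : R) :
  0 < h ->
  (forall s t, 0 <= s <= h -> 0 <= t <= h -> D (a + s *: u + t *: v)) ->
  (forall b, D b -> differentiable f b) ->
  (forall b, D b -> differentiable (fun c => 'D_u f c) b) ->
  exists b, (exists2 s, 0 <= s <= h & exists2 t, 0 <= t <= h &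
      b = a + s *: u + t *: v) /\
    (f (a + h *: u + h *: v) - f (a + h *: u)) - (f (a + h *: v) - f a) =
    h * (h * 'D_v (fun c => 'D_u f c) b).
Proof.
move=> h0 inD df dDf.
have hh : 0 <= h <= h by rewrite (ltW h0) lexx.
have h00 : 0 <= (0 : R) <= h by rewrite lexx (ltW h0).
have inD0 s : 0 <= s <= h -> D (a + s *: u).
  by move=> sh; have := inD s 0 sh h00; rewrite scale0r addr0.
pose w := h *: v.
have dfw s : 0 <= s <= h -> differentiable (fun c => f (c + w)) (a + s *: u).
  move=> sh; apply: (@differentiable_comp _ _ _ _ (fun c => c + w) f).
    exact: differentiable_addr.
  exact/df/inD.
have dfs s : 0 <= s <= h -> differentiable f (a + s *: u).
  by move=> sh; apply/df/inD0.
(* The mean value theorem is used along [u] on the increment [c |-> f (c + h v) - f c], then along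
   [v] on the derivative of [f] along [u]. *)
have [s sh] := @MVT_line ((fun c => f (c + w)) - f) a u h h0
  (fun s sh => differentiableB (dfw s sh) (dfs s sh)).
rewrite !fctE /= => es.
have [t th] := @MVT_line (fun c => 'D_u f c) (a + s *: u) v h h0
  (fun t th => dDf _ (inD s t sh th)).
move=> et; exists (a + s *: u + t *: v); split.
  by exists s => //; exists t.
rewrite es; congr (_ * _); rewrite -et.
by rewrite deriveB ?derive_shiftr//; apply: diff_derivable; [apply: dfw|apply: dfs].
Qed.

Lemma derive_sym (D : set 'rV[R]_m) f a u v : open D -> D a ->
  (forall b, D b -> differentiable f b) ->
  (forall b, D b -> differentiable (fun c => 'D_u f c) b) ->
  (forall b, D b -> differentiable (fun c => 'D_v f c) b) ->
  {for a, continuous (fun c => 'D_u (fun b => 'D_v f b) c)} ->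
  {for a, continuous (fun c => 'D_v (fun b => 'D_u f b) c)} ->
  'D_u (fun b => 'D_v f b) a = 'D_v (fun b => 'D_u f b) a.
Proof.
move=> oD Da df du dv cuv cvu.
set A := fun c => 'D_u (fun b => 'D_v f b) c.
set B := fun c => 'D_v (fun b => 'D_u f b) c.
apply/eqP/negPn/negP => neAB.
(* Half the supposed gap: a common value of [A] and [B] at nearby points would be closer than [e] to
   both [A a] and [B a]. *)
pose e := `|A a - B a| / 2.
have e0 : 0 < e by rewrite divr_gt0// normr_gt0 subr_eq0.
have nA1 : \forall c \near a, `|A a - A c| < e.
  have cA : A c @[c --> a] --> A a := cuv.
  exact: (proj1 (@cvgrPdist_lt _ _ _ _ _ _ _) cA e e0).
have nA2 : \forall c \near a, `|B a - B c| < e.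
  have cB : B c @[c --> a] --> B a := cvu.
  exact: (proj1 (@cvgrPdist_lt _ _ _ _ _ _ _) cB e e0).
have nA : \forall c \near a, D c /\ `|A a - A c| < e /\ `|B a - B c| < e.
  have nD : nbhs a D by exact: open_nbhs_nbhs.
  exact: filterI nD (filterI nA1 nA2).
have [r /= r0 rP] := (@nbhs_ballP _ _ _ _).1 nA.
(* The points used lie within [h * n = r / 2] of [a]; the summand 1 keeps [n] positive when [u] and
   [v] vanish. *)
pose n := `|u| + `|v| + 1.
have n0 : 0 < n by rewrite ltr_wpDl.
pose h := r / n / 2.
have h0 : 0 < h by rewrite !divr_gt0.
have inr s t : 0 <= s <= h -> 0 <= t <= h ->
    D (a + s *: u + t *: v) /\ `|A a - A (a + s *: u + t *: v)| < e /\
    `|B a - B (a + s *: u + t *: v)| < e.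
  move=> /andP[s0 sh] /andP[t0 th]; apply: rP.
  rewrite -ball_normE /= -addrA opprD addrA subrr sub0r normrN.
  rewrite (le_lt_trans (ler_normD _ _))// !normrZ !ger0_norm//.
  rewrite (@le_lt_trans _ _ (h * `|u| + h * `|v|)) ?lerD ?ler_wpM2r//.
  rewrite -mulrDr (@le_lt_trans _ _ (h * n)) ?ler_wpM2l ?lerDl ?(ltW h0)//.
  by rewrite /h mulrAC divfK ?gt_eqF// ltr_pdivrMr// ltr_pMr// ltr1n.
have [b1 [[s1 sh1 [t1 th1 e1]]]] := second_difference h0
  (fun s t sh th => (inr s t sh th).1) df du.
have [b2 [[t2 th2 [s2 sh2 e2]]]] := @second_difference D f a v u h h0
  (fun s t sh th => eq_ind _ D (inr t s th sh).1 _ (addrAC _ _ _)) df dv.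
rewrite (addrAC a (h *: v)) => E2 E1.
have {E1 E2} EAB : A b2 = B b1.
  have hn0 := lt0r_neq0 h0.
  have EE : h * (h * A b2) = h * (h * B b1).
    by rewrite -[LHS]E2 -[RHS]E1; ring.
  have {EE} EE : h * A b2 = h * B b1 := mulfI hn0 EE.
  exact: mulfI hn0 _ _ EE.
have [_ [+ _]] := inr s2 t2 sh2 th2; have [_ [_]] := inr s1 t1 sh1 th1.
rewrite -e1 (addrAC a) -e2 EAB => B1 A2.
have := ltr_distD2 A2 B1.
by rewrite -splitr ltxx.
Qed.
End MixedPartials.

(** * Functions of class C^k *)

Section Smoothness.
Context {R : realType} {m : nat}.
Implicit Types (D : set 'rV[R]_m) (f g : 'rV[R]_m -> R).

Lemma Ck_continuous k D f a : Ck k D f -> D a -> {for a, continuous f}.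
Proof.
by case: k => [|k] /= => [fc Da|[df _] Da]; [exact: fc|exact/differentiable_continuous/df].
Qed.

Lemma CkW k D f : Ck k.+1 D f -> Ck k D f.
Proof.
elim: k f => [|k IH] f /= [df pf].
  by move=> a Da; exact/differentiable_continuous/df.
by split=> // i; apply: IH.
Qed.

Lemma Ck_sub k D D' f : D' `<=` D -> Ck k D f -> Ck k D' f.
Proof.
move=> DD'; elim: k f => [|k IH] f /=; first by move=> fc a /DD'/fc.
by move=> [df pf]; split=> [a /DD'/df //|i]; exact: IH.
Qed.

(** [Ck k D f] is a condition at each point of [D] on derivatives of the total function [f], and
    these derivatives do not depend on [D]. *)
Lemma Ck_local k D f :
  (forall a, D a -> exists2 E : set _, E a & Ck k E f) -> Ck k D f.
Proof.
elim: k f => [|k IH] f /= fE.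
  by move=> a Da; have [E Ea] := fE a Da; exact.
split=> [a Da|i]; first by have [E Ea [df _]] := fE a Da; exact: df.
by apply: IH => a Da; have [E Ea [_ pf]] := fE a Da; exists E.
Qed.

Lemma near_open D f g a : open D -> {in D, f =1 g} -> D a ->
  \forall b \near a, f b = g b.
Proof.
move=> oD fg Da; have := open_nbhs_nbhs (conj oD Da).
by apply: filterS => b Db; apply: fg; rewrite inE.
Qed.

Lemma Ck_eq k D f g : open D -> {in D, f =1 g} -> Ck k D f -> Ck k D g.
Proof.
move=> oD; elim: k f g => [|k IH] f g fg /=.
  move=> fc a Da; have fgn := near_open oD fg Da.
  have /fc fca := Da; suff : g @ a --> f a by rewrite (nbhs_singleton fgn).
  exact: cvg_trans (@near_eq_cvg _ _ (nbhs a) _ f g fgn) fca.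
move=> [df pf]; split=> [a Da|i].
  exact: near_eq_differentiable (near_open oD fg Da) (df a Da).
apply: IH (pf i) => a; rewrite inE => Da.
exact: near_eq_derive (near_open oD fg Da).
Qed.

Lemma Ck_cst k D (c : R) : Ck k D (fun=> c).
Proof.
elim: k c => [|k IH] c /=; first by move=> a _; exact: cst_continuous.
split=> [a _|i]; first exact: differentiable_cst.
have -> : (fun a : 'rV[R]_m => 'D_(delta_mx 0 i) (fun=> c) a) = (fun=> 0 : R).
  by apply/funext => a; exact: (derive_cst c).
exact: IH.
Qed.

Lemma Ck_add k D f g : open D -> Ck k D f -> Ck k D g ->
  Ck k D (fun a => f a + g a).
Proof.
move=> oD; elim: k f g => [|k IH] f g /=.
  by move=> fc gc a Da; exact: (continuousD (fc a Da) (gc a Da)).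
move=> [df pf] [dg pg]; split=> [a Da|i].
  by apply: differentiableD; [exact: df|exact: dg].
apply: Ck_eq (IH _ _ (pf i) (pg i)) => // a; rewrite inE => Da.
by rewrite deriveD//; apply/diff_derivable; [exact: df|exact: dg].
Qed.

Lemma Ck_mul k D f g : open D -> Ck k D f -> Ck k D g ->
  Ck k D (fun a => f a * g a).
Proof.
move=> oD; elim: k f g => [|k IH] f g.
  by move=> fc gc a Da; exact: (continuousM (fc a Da) (gc a Da)).
move=> fk gk; have [[df pf] [dg pg]] := (fk, gk); split=> [a Da|i].
  by apply: differentiableM; [exact: df|exact: dg].
apply: (@Ck_eq _ _ (fun a => f a * 'D_(delta_mx 0 i) g a +
    g a * 'D_(delta_mx 0 i) f a)) => // [a|].
  rewrite inE => Da.
  by rewrite deriveM//; apply/diff_derivable; [exact: df|exact: dg].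
exact: (Ck_add oD (IH _ _ (CkW fk) (pg i)) (IH _ _ (CkW gk) (pf i))).
Qed.

Lemma Ck_opp k D f : open D -> Ck k D f -> Ck k D (fun a => - f a).
Proof.
move=> oD fk; apply: (@Ck_eq _ _ (fun a => (-1) * f a)) => //.
  by move=> a _; rewrite mulN1r.
exact: (Ck_mul oD (Ck_cst k D (-1)) fk).
Qed.

Lemma Ck_sum k D (I : Type) (r : seq I) (F : I -> 'rV[R]_m -> R) : open D ->
  (forall i, Ck k D (F i)) -> Ck k D (fun a => \sum_(i <- r) F i a).
Proof.
move=> oD Fk; elim: r => [|i r IH].
  by under eq_fun do rewrite big_nil; exact: Ck_cst.
by under eq_fun do rewrite big_cons; exact: Ck_add.
Qed.

Lemma derive_coord (j : 'I_m) (v a : 'rV[R]_m) :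
  'D_v (fun b : 'rV[R]_m => b 0 j) a = v 0 j.
Proof.
have /matrixP/(_ 0 j) : 'D_v (@id 'rV[R]_m) a = \matrix_(k, l)
    'D_v (fun b : 'rV[R]_m => id b k l) a.
  by apply: derive_mx; exact: derivable_id.
by rewrite derive_id [in RHS]mxE => <-.
Qed.

Lemma Ck_coord k D (j : 'I_m) : Ck k D (fun a => a 0 j).
Proof.
case: k => [|k] /=; first by move=> a _; exact: coord_continuous.
split=> [a _|i]; first exact: differentiable_coord.
under eq_fun do rewrite derive_coord; exact: Ck_cst.
Qed.

(** The derivative of the inverse is a product of two copies of the inverse and a derivative of [f],
    so the induction runs on the order with [f] fixed. *)
Lemma Ck_inv k D f : open D -> (forall a, D a -> f a != 0) ->
  Ck k D f -> Ck k D (fun a => (f a)^-1).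
Proof.
move=> oD f0; elim: k => [|k IH] fk.
  by move=> a Da; exact: (continuousV (f0 a Da) (fk a Da)).
have [df pf] := fk; have fk' := CkW fk; split=> [a Da|i].
  by apply: differentiableV; [exact: df|exact: f0].
apply: (@Ck_eq _ _ (fun a => - ((f a)^-1 * (f a)^-1 *
    'D_(delta_mx 0 i) f a))) => // [a|].
  rewrite inE => Da; rewrite deriveV//; [|exact: f0|exact/diff_derivable/df].
  by rewrite -exprVn expr2 -mulNr.
exact: (Ck_opp oD (Ck_mul oD (Ck_mul oD (IH fk') (IH fk')) (pf i))).
Qed.

Lemma Ck_ln k D f : open D -> (forall a, D a -> 0 < f a) ->
  Ck k D f -> Ck k D (fun a => ln (f a)).
Proof.
move=> oD f0; case: k => [|k] fk.
  move=> a Da; apply: (@continuous_comp _ _ _ f (@ln R)); first exact: fk.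
  exact/continuous_ln/f0.
have dln a : D a -> differentiable (@ln R) (f a).
  by move=> Da; apply/derivable1_diffP; have [] := is_derive1_ln (f0 a Da).
have [df pf] := fk; have fk' := CkW fk; split=> [a Da|i].
  by apply: (@differentiable_comp _ _ _ _ f (@ln R)); [exact: df|exact: dln].
apply: (@Ck_eq _ _ (fun a => (f a)^-1 * 'D_(delta_mx 0 i) f a)) => // [a|].
  rewrite inE => Da; rewrite -[RHS]/('D_ _ (@ln R \o f) a).
  rewrite (derive_compR _ (df a Da) (dln a Da)).
  by have [_ ->] := is_derive1_ln (f0 a Da).
apply: Ck_mul => //; last exact: pf.
by apply: Ck_inv => // a /f0; exact: lt0r_neq0.
Qed.

End Smoothness.

(** One order is given up so that the base case can obtain continuity from differentiability. For
    [Cinf] data any order is available, so nothing is lost. *)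
Lemma Ck_comp (R : realType) m l k (D : set 'rV[R]_m) (E : set 'rV[R]_l)
    (f : 'rV[R]_l -> R) (G : 'rV[R]_m -> 'rV[R]_l) : open D ->
  (forall a, D a -> E (G a)) -> Ck k.+1 E f ->
  (forall j, Ck k.+1 D (fun a => G a 0 j)) -> Ck k D (f \o G).
Proof.
move=> oD DE; elim: k f => [|k IH] f fk Gk.
  move=> a Da; apply/differentiable_continuous/differentiable_comp.
    by apply: differentiable_row => j; have [+ _] := Gk j; exact.
  by have [+ _] := fk; apply; exact: DE.
have [df pf] := fk; have dG a j : D a -> differentiable (fun b => G b 0 j) a.
  by move=> Da; have [+ _] := Gk j; exact.
split=> [a Da|i].
  by apply: differentiable_comp; [apply: differentiable_row => j; exact: dG|exact/df/DE].
apply: (@Ck_eq _ _ _ _ (fun a => \sum_j 'D_(delta_mx 0 i) (fun b => G b 0 j) a *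
    ((fun b => 'D_(delta_mx 0 j) f b) \o G) a)) => // [a|].
  rewrite inE => Da; rewrite derive_comp_row//; first exact/df/DE.
  by move=> j; exact: dG.
apply: Ck_sum => // j; apply: Ck_mul => //.
  by have [_] := CkW (Gk j); exact.
by apply: IH; [exact: pf|move=> j'; exact: CkW].
Qed.

(** * Flat functions and bump functions on row vectors *)

Section FlatFunction.
Context {R : realType}.
Implicit Types (t : R) (j : nat).

(* [expR (- t^-1) / t ^+ j], continued by [0] to [t <= 0]: a family closed under
   linear combinations of derivatives. *)
Definition flat j t : R := if 0 < t then t^-1 ^+ j * expR (- t^-1) else 0.

Lemma flat_gt0 j t : 0 < t -> 0 < flat j t.
Proof. by move=> t0; rewrite /flat t0 mulr_gt0 ?expR_gt0// exprn_gt0// invr_gt0. Qed.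

Lemma flat_le0 j t : t <= 0 -> flat j t = 0.
Proof. by rewrite /flat leNgt => /negbTE ->. Qed.

(** A bound on the difference quotient at 0. With [u = t^-1] positive it says that
    [u ^ (j + 2) <= (j + 2)! * expR u], which follows from one term of the exponential series. *)
Lemma flat_bound j t : `|t^-1 * flat j t| <= (j.+2)`!%:R * `|t|.
Proof.
have [t0|t0] := leP t 0; first by rewrite flat_le0// mulr0 normr0 mulr_ge0.
rewrite /flat t0 mulrA -exprS ger0_norm; last first.
  by rewrite mulr_ge0 ?expR_ge0// exprn_ge0// invr_ge0 ltW.
rewrite gtr0_norm// -ler_pdivrMr// mulrAC -exprSr expRN.
set u := t^-1; have u0 : 0 < u by rewrite invr_gt0.
rewrite ler_pdivrMr ?expR_gt0// mulrC -ler_pdivrMr ?ltr0n ?fact_gt0//.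
by rewrite (le_trans _ (expR_ge1Dxn j.+1 (ltW u0)))// lerDr ler01.
Qed.

Lemma is_derive_flat j t :
  is_derive t 1 (flat j) (flat j.+2 t - j%:R * flat j.+1 t).
Proof.
have [t0|t0|->] := ltgtP t 0.
- rewrite !flat_le0 ?(ltW t0)// mulr0 subr0.
  apply: (@near_eq_is_derive _ _ _ (cst 0)).
  by near=> s; rewrite flat_le0// ltW//; near: s; exact: lt_nbhsl.
- have tn0 : t != 0 by rewrite gt_eqF.
  have dV : is_derive t 1 (fun s : R => s^-1) (- t ^- 2 *: 1).
    exact: (@is_deriveV _ id).
  have dE : is_derive t 1 (expR \o (- (fun s : R => s^-1)))
      (expR (- t^-1) * (- (- t ^- 2 *: 1))).
    exact: is_derive1_comp.
  have dP := is_deriveM (is_deriveX j dV) dE.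
  have fE : \forall s \near t, ((fun s : R => s^-1) ^+ j *
      (expR \o (- (fun s : R => s^-1)))) s = flat j s.
    near=> s; rewrite /flat ifT; last by near: s; exact: lt_nbhsr.
    by rewrite !fctE.
  have Q := near_eq_is_derive fE dP; apply: (is_derive_eq Q).
  rewrite /flat t0 /GRing.scale /= !mulr1 opprK -!exprVn !fctE /=.
  clear; case: j => [|j] /=; first by rewrite mulr0n !mul0r; ring.
  rewrite -mulr_natl !exprS; ring.
- rewrite !flat_le0// mulr0 subr0.
  (* At 0 the difference quotient tends to 0, being bounded by a constant times [|h|]. *)
  have E : h^-1 *: ((flat j \o shift 0) (h *: 1) - flat j 0) @[h --> 0^'] --> (0 : R).
    apply/cvgrPdist_le => e e0; near=> h.
    rewrite sub0r normrN /= addr0 [flat j 0]flat_le0// subr0 [h%:A]mulr1.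
    rewrite (le_trans (flat_bound _ _))//.
    rewrite -ler_pdivlMl ?ltr0n ?fact_gt0//.
    near: h; apply: dnbhs0_le; rewrite mulr_gt0// invr_gt0 ltr0n fact_gt0//.
  apply: DeriveDef; first by apply/cvg_ex; exists 0.
  exact: cvg_lim E.
Unshelve. all: by end_near. Qed.

Lemma Ck_flat m k (D : set 'rV[R]_m) f j : open D -> Ck k D f ->
  Ck k D (fun a => flat j (f a)).
Proof.
move=> oD; elim: k j => [|k IH] j fk.
  move=> a Da; apply: (@continuous_comp _ _ _ f (flat j)); first exact: fk.
  apply/differentiable_continuous/derivable1_diffP.
  by have [] := is_derive_flat j (f a).
have dfl t : differentiable (flat j) t.
  by apply/derivable1_diffP; have [] := is_derive_flat j t.
have [df pf] := fk; have fk' := CkW fk; split=> [a Da|i].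
  by apply: (@differentiable_comp _ _ _ _ f (flat j)); [exact: df|exact: dfl].
apply: (@Ck_eq _ _ _ _ (fun a => (flat j.+2 (f a) - j%:R * flat j.+1 (f a))
    * 'D_(delta_mx 0 i) f a)) => // [a|].
  rewrite inE => Da; rewrite -[RHS]/('D_ _ (flat j \o f) a).
  rewrite (derive_compR _ (df a Da) (dfl _)).
  by have [_ ->] := is_derive_flat j (f a).
apply: (Ck_mul oD _ (pf i)).
exact: (Ck_add oD (IH _ fk') (Ck_opp oD (Ck_mul oD (Ck_cst _ _ _) (IH _ fk')))).
Qed.

End FlatFunction.

(** The norm on row vectors is the sup norm, which is not smooth, so [b] is a flat function of a sum
    of squares. Its support lies in a Euclidean ball of radius [s], hence in the sup-norm ball of
    that radius; [s = r / 2] makes the inclusion in the open ball strict. Compactness of [K] is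
    needed to transport it through a chart. *)
Lemma ball_bump (R : realType) m (c : 'rV[R]_m) (r : R) : 0 < r ->
  exists b : 'rV[R]_m -> R, exists K : set 'rV[R]_m,
    [/\ Cinf setT b, 0 < b c, compact K, K `<=` ball c r &
      forall a, ~ K a -> b a = 0].
Proof.
move=> r0; pose s := r / 2; have s0 : 0 < s by rewrite divr_gt0.
pose u := fun a : 'rV[R]_m => s ^+ 2 - \sum_i (a 0 i - c 0 i) ^+ 2.
have oT : open [set: 'rV[R]_m] by exact: openT.
have uC k : Ck k setT u.
  apply: (Ck_add oT (Ck_cst _ _ _)); apply: (Ck_opp oT); apply: (Ck_sum _ oT) => i.
  have h : Ck k setT (fun a : 'rV[R]_m => a 0 i - c 0 i).
    exact: (Ck_add oT (Ck_coord _ _ _) (Ck_cst _ _ _)).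
  by apply: (Ck_eq oT _ (Ck_mul oT h h)) => a _; rewrite expr2.
have ule a : 0 <= u a -> forall i, `|a 0 i - c 0 i| <= s.
  move=> ua i; rewrite -(@ler_pXn2r _ 2)// ?nnegrE ?(ltW s0)// real_normK ?num_real//.
  move: ua; rewrite subr_ge0; apply: le_trans.
  by rewrite (bigD1 i)//= lerDl sumr_ge0// => j _; exact: sqr_ge0.
have uc : continuous u by move=> a; exact: (Ck_continuous (uC 0%N)).
exists (fun a => flat 0 (u a)), [set a | 0 <= u a]; split.
- by move=> k; exact: Ck_flat.
- rewrite flat_gt0// /u big1 ?subr0 ?exprn_gt0// => i _.
  by rewrite subrr expr0n.
- apply: bounded_closed_compact.
    exists (s + `|c|); split; first exact: num_real.
    move=> M cM a ua; rewrite /= -[a](subrK c).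
    rewrite (le_trans (ler_normD _ _))// (le_trans _ (ltW cM))// lerD//.
    rewrite /Num.Def.normr /= mx_normrE; apply/bigmax_leP; split; first exact: ltW.
    by move=> [i j] _ /=; rewrite !mxE ord1; exact: ule.
  have -> : [set a | 0 <= u a] = u @^-1` [set t | 0 <= t] by [].
  by apply: closed_comp => [a _|]; [exact: uc|exact: closed_ge].
- move=> a ua; rewrite -ball_normE /= distrC.
  rewrite (@le_lt_trans _ _ s)//; last by rewrite ltr_pdivrMr// ltr_pMr// ltr1n.
  rewrite /Num.Def.normr /= mx_normrE; apply/bigmax_leP; split; first exact: ltW.
  by move=> [i j] _ /=; rewrite !mxE ord1; exact: ule.
- by move=> a /= /negP; rewrite -ltNge => /ltW; exact: flat_le0.
Qed.

(** * Smooth functions and vector fields on manifolds *)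

(* [is_manifold] without second countability, which would otherwise have to be
   proved for the cylinder. *)
Definition has_atlas (R : realType) m (M : charted R m) : Prop :=
  [/\ hausdorff_space M,
      forall x : M, [/\ open (cdom x), cdom x x & open (cmap x @` cdom x)],
      forall x : M, [/\ {in cdom x, cancel (cmap x) (cinv x)},
        {within cdom x, continuous (cmap x)} &
        {within cmap x @` cdom x, continuous (cinv x)}] &
      forall (x y : M) (j : 'I_m),
        Cinf (cmap x @` (cdom x `&` cdom y)) (fun a => cmap y (cinv x a) 0 j)].

Lemma manifold_has_atlas (R : realType) m (M : charted R m) :
  is_manifold M -> has_atlas M.
Proof.
by move=> [hM _ aM tM]; split=> // x; have [] := aM x.
Qed.

Lemma near_open_set (T : topologicalType) (U : set T) (y : T) :
  open U -> U y -> \forall z \near y, U z.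
Proof. by move=> oU Uy; exact: open_nbhs_nbhs. Qed.

Section Charts.
Context {R : realType} {m : nat} {M : charted R m}.
Implicit Types (x y z : M) (U V : set M) (f g : M -> R) (v w : 'rV[R]_m).

Hypothesis HM : has_atlas M.

Lemma cdom_open x : open (cdom x). Proof. by case: HM => _ /(_ x)[]. Qed.
Lemma cdomxx x : cdom x x. Proof. by case: HM => _ /(_ x)[]. Qed.
Lemma cimg_open x : open (cmap x @` cdom x).
Proof. by case: HM => _ /(_ x)[]. Qed.

Lemma cmapK x y : cdom x y -> cinv x (cmap x y) = y.
Proof. by case: HM => _ _ /(_ x)[+ _ _] _ xy; apply; rewrite inE. Qed.

Lemma cinv_cdom x a : (cmap x @` cdom x) a -> cdom x (cinv x a).
Proof. by move=> [y xy <-]; rewrite cmapK. Qed.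

Lemma cinvK x a : (cmap x @` cdom x) a -> cmap x (cinv x a) = a.
Proof. by move=> [y xy <-]; rewrite cmapK. Qed.

Lemma cmap_continuous x y : cdom x y -> {for y, continuous (cmap x)}.
Proof.
case: HM => _ _ /(_ x)[_ + _] _ xy.
by rewrite (continuous_open_subspace _ (@cdom_open x)); apply; rewrite inE.
Qed.

Lemma cinv_continuous x a : (cmap x @` cdom x) a -> {for a, continuous (cinv x)}.
Proof.
case: HM => _ _ /(_ x)[_ _ +] _ xy.
by rewrite (continuous_open_subspace _ (@cimg_open x)); apply; rewrite inE.
Qed.

Lemma cimgP x U a :
  (cmap x @` (U `&` cdom x)) a <-> (cmap x @` cdom x) a /\ U (cinv x a).
Proof.
split=> [[y [Uy xy] <-]|[[y xy <-]]]; first by rewrite cmapK//; split=> //; exists y.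
by rewrite cmapK// => Uy; exists y.
Qed.

Lemma chart_open x U : open U -> open (cmap x @` (U `&` cdom x)).
Proof.
move=> oU; rewrite openE => a /cimgP[xa Ua].
have n1 : nbhs a (cmap x @` cdom x) by exact: open_nbhs_nbhs (conj (@cimg_open x) xa).
have n2 : nbhs a (cinv x @^-1` U).
  by apply: (cinv_continuous xa); exact: open_nbhs_nbhs (conj oU Ua).
by apply: filterS (filterI n1 n2) => b ?; apply/cimgP.
Qed.

Lemma near_chart x y (P : set M) : cdom x y -> (\forall z \near y, P z) ->
  \forall a \near cmap x y, P (cinv x a).
Proof.
move=> xy Py; have xa : (cmap x @` cdom x) (cmap x y) by exists y.
by apply: (cinv_continuous xa); rewrite cmapK.
Qed.

Lemma smooth_local U f :
  (forall y, U y -> exists2 V : set M, V y & smooth_on V f) -> smooth_on U f.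
Proof.
move=> H x k; apply: Ck_local => _ [y [Uy xy] <-]; have [V Vy fV] := H y Uy.
by exists (cmap x @` (V `&` cdom x)); [exists y|exact: fV].
Qed.

Lemma smooth_sub U V f : V `<=` U -> smooth_on U f -> smooth_on V f.
Proof.
by move=> VU sf x k; apply: Ck_sub (sf x k) => _ [y [/VU Uy xy] <-]; exists y.
Qed.

Lemma smooth_eq U f g : open U -> {in U, f =1 g} -> smooth_on U f -> smooth_on U g.
Proof.
move=> oU fg sf x k; apply: Ck_eq (sf x k); first exact: chart_open.
by move=> a; rewrite inE => /cimgP[_ Ua]; apply: fg; rewrite inE.
Qed.

Lemma smooth_cst U (c : R) : smooth_on U (fun=> c).
Proof. by move=> x k; exact: Ck_cst. Qed.

Lemma smooth_add U f g : open U -> smooth_on U f -> smooth_on U g ->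
  smooth_on U (fun y => f y + g y).
Proof. by move=> oU sf sg x k; exact: (Ck_add (@chart_open x _ oU) (sf x k) (sg x k)). Qed.

Lemma smooth_mul U f g : open U -> smooth_on U f -> smooth_on U g ->
  smooth_on U (fun y => f y * g y).
Proof. by move=> oU sf sg x k; exact: (Ck_mul (@chart_open x _ oU) (sf x k) (sg x k)). Qed.

Lemma smooth_opp U f : open U -> smooth_on U f -> smooth_on U (fun y => - f y).
Proof. by move=> oU sf x k; exact: (Ck_opp (@chart_open x _ oU) (sf x k)). Qed.

Lemma smooth_sum (I : Type) (r : seq I) U (F : I -> M -> R) : open U ->
  (forall i, smooth_on U (F i)) -> smooth_on U (fun y => \sum_(i <- r) F i y).
Proof.
move=> oU sF x k.
by apply: (@Ck_sum _ _ k _ _ r (fun i => F i \o cinv x) (@chart_open x _ oU)) => i; exact: sF.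
Qed.

Lemma smooth_inv U f : open U -> (forall y, U y -> f y != 0) ->
  smooth_on U f -> smooth_on U (fun y => (f y)^-1).
Proof.
move=> oU f0 sf x k; apply: (Ck_inv (@chart_open x _ oU) _ (sf x k)) => a.
by move=> /cimgP[_ /f0].
Qed.

Lemma smooth_ln U f : open U -> (forall y, U y -> 0 < f y) ->
  smooth_on U f -> smooth_on U (fun y => ln (f y)).
Proof.
move=> oU f0 sf x k; apply: (Ck_ln (@chart_open x _ oU) _ (sf x k)) => a.
by move=> /cimgP[_ /f0].
Qed.

(** In any other chart [z] the function is [f \o cinv x] composed with the transition map
    [cmap x \o cinv z], which the atlas makes smooth. *)
Lemma smooth_chart x U f : open U -> U `<=` cdom x ->
  Cinf (cmap x @` (U `&` cdom x)) (f \o cinv x) -> smooth_on U f.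
Proof.
move=> oU Ux sf z k; have oD := @chart_open z _ oU.
have zx a : (cmap z @` (U `&` cdom z)) a -> cdom x (cinv z a).
  by move=> /cimgP[_ /Ux].
apply: (@Ck_eq _ _ _ _ ((f \o cinv x) \o (cmap x \o cinv z))) => // [a|].
  by rewrite inE => /zx xa /=; rewrite cmapK.
apply: (Ck_comp oD _ (sf k.+1)) => [a /cimgP[za Ua]|j].
  by exists (cinv z a) => //; split=> //; exact: Ux.
case: HM => _ _ _ /(_ z x j k.+1); apply: Ck_sub => a /cimgP[za Ua].
by exists (cinv z a); [split; [exact: cinv_cdom|exact: Ux]|exact: cinvK].
Qed.

Lemma smooth_coord x j : smooth_on (cdom x) (fun y => cmap x y 0 j).
Proof.
apply: (@smooth_chart x _ _ (@cdom_open x)) => // k.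
apply: (@Ck_eq _ _ _ _ (fun a => a 0 j)); [exact/chart_open/cdom_open| |exact: Ck_coord].
by move=> a; rewrite inE => /cimgP[/cinvK /= ->].
Qed.

Lemma smooth_differentiable x y U f : U y -> cdom x y -> smooth_on U f ->
  differentiable (f \o cinv x) (cmap x y).
Proof. by move=> Uy xy sf; have [+ _] := sf x 1%N; apply; exists y. Qed.

(** Here the chart [x] stays fixed while [y] moves, whereas [dirder] uses the chart of its base
    point. This is the form in which smoothness in [y] is visible. *)
Definition partial x (i : 'I_m) f y : R := 'D_(delta_mx 0 i) (f \o cinv x) (cmap x y).

Definition coordv x (i : 'I_m) y : tangent M y := frame (v := tangent M) x i y.

Lemma smooth_partial x U f i : open U -> smooth_on U f ->
  smooth_on (U `&` cdom x) (partial x i f).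
Proof.
move=> oU sf; have oUx : open (U `&` cdom x) by apply: openI => //; exact: cdom_open.
apply: (@smooth_chart x _ _ oUx) => [y []//|k].
rewrite -setIA setIid.
apply: (@Ck_eq _ _ _ _ (fun a => 'D_(delta_mx 0 i) (f \o cinv x) a)).
- exact: chart_open.
- by move=> a; rewrite inE => /cimgP[/cinvK + _] /=; rewrite /partial => ->.
- by have [_] := sf x k.+1; exact.
Qed.

Lemma dirder_eq x v f g : (\forall z \near x, f z = g z) -> dirder x v f = dirder x v g.
Proof. by move=> fg; apply: near_eq_derive; exact: (near_chart (cdomxx x) fg). Qed.

Lemma dirder_cst x v (c : R) : dirder x v (fun=> c) = 0.
Proof. exact: (derive_cst c). Qed.

Section Germ.
Variables (x : M) (U : set M).
Hypothesis Ux : U x.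

Let diff f : smooth_on U f -> differentiable (f \o cinv x) (cmap x x).
Proof. by move=> sf; exact: smooth_differentiable Ux (cdomxx x) sf. Qed.

Lemma dirderDv v w f : smooth_on U f -> dirder x (v + w) f = dirder x v f + dirder x w f.
Proof. by move=> /diff; exact: derive_addr. Qed.

Lemma dirderZv (k : R) v f : smooth_on U f -> dirder x (k *: v) f = k * dirder x v f.
Proof. by move=> /diff; exact: derive_scaler. Qed.

Lemma dirder_sumv (I : Type) (r : seq I) (F : I -> 'rV[R]_m) f : smooth_on U f ->
  dirder x (\sum_(i <- r) F i) f = \sum_(i <- r) dirder x (F i) f.
Proof.
move=> sf; elim: r => [|i r IH]; last by rewrite !big_cons dirderDv// IH.
by rewrite !big_nil -(scale0r 0) dirderZv// mul0r.
Qed.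

Lemma dirderD v f g : smooth_on U f -> smooth_on U g ->
  dirder x v (fun y => f y + g y) = dirder x v f + dirder x v g.
Proof.
move=> /diff df /diff dg.
exact: (deriveD (diff_derivable df) (diff_derivable dg)).
Qed.

Lemma dirderM v f g : smooth_on U f -> smooth_on U g ->
  dirder x v (fun y => f y * g y) = f x * dirder x v g + g x * dirder x v f.
Proof.
move=> /diff df /diff dg.
have /= := deriveM (@diff_derivable _ _ _ _ _ v df) (diff_derivable dg).
by rewrite /= cmapK//; exact: cdomxx.
Qed.

Lemma dirderZ v (k : R) f : smooth_on U f ->
  dirder x v (fun y => k * f y) = k * dirder x v f.
Proof.
by move=> sf; rewrite dirderM ?dirder_cst ?mulr0 ?addr0//; exact: smooth_cst.
Qed.

Lemma dirderN v f : smooth_on U f -> dirder x v (fun y => - f y) = - dirder x v f.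
Proof.
move=> sf; rewrite -mulN1r -dirderZ//; congr dirder.
by apply/funext => y; rewrite mulN1r.
Qed.

Lemma dirderB v f g : open U -> smooth_on U f -> smooth_on U g ->
  dirder x v (fun y => f y - g y) = dirder x v f - dirder x v g.
Proof. by move=> oU sf sg; rewrite dirderD ?dirderN//; exact: smooth_opp. Qed.

Lemma dirder_sum (I : Type) (r : seq I) v (F : I -> M -> R) : open U ->
  (forall i, smooth_on U (F i)) ->
  dirder x v (fun y => \sum_(i <- r) F i y) = \sum_(i <- r) dirder x v (F i).
Proof.
move=> oU sF; elim: r => [|i r IH].
  by rewrite big_nil; under eq_fun do rewrite big_nil; exact: dirder_cst.
rewrite big_cons -IH -dirderD//; last exact: smooth_sum.
by under eq_fun do rewrite big_cons.
Qed.

Lemma dirder_ln v f : smooth_on U f -> 0 < f x ->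
  dirder x v (fun y => ln (f y)) = (f x)^-1 * dirder x v f.
Proof.
move=> /diff df f0.
have e : f (cinv x (cmap x x)) = f x by rewrite cmapK//; exact: cdomxx.
have [dl vl] := is_derive1_ln f0.
have := @derive_compR _ _ (@ln R) _ _ v df; rewrite /= e vl.
by apply; exact/derivable1_diffP.
Qed.

End Germ.

(** Chain rule through the transition from the moving chart at [y] to the fixed chart [x]; the
    coefficients are the components of [v] in the latter. *)
Lemma dirder_partial x y U v f : open U -> U y -> cdom x y -> smooth_on U f ->
  dirder y v f = \sum_j dirder y v (fun z => cmap x z 0 j) * partial x j f y.
Proof.
move=> oU Uy xy sf.
have -> : dirder y v f = 'D_v ((f \o cinv x) \o (cmap x \o cinv y)) (cmap y y).
  apply: near_eq_derive.
  apply: (near_chart (cdomxx y) (P := fun z => f z = f (cinv x (cmap x z)))).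
  by apply: filterS (near_open_set (@cdom_open x) xy) => z xz /=; rewrite cmapK.
have e : cinv y (cmap y y) = y by rewrite cmapK//; exact: cdomxx.
rewrite derive_comp_row /= ?e//; first exact: smooth_differentiable sf.
by move=> j; exact: smooth_differentiable xy (cdomxx y) (@smooth_coord x j).
Qed.

(** The components of [coordv x i y] are derivatives of the transition [cmap y \o cinv x], so this
    is the chain rule in the opposite direction. *)
Lemma dirder_coordv x y U i f : open U -> U y -> cdom x y -> smooth_on U f ->
  dirder y (coordv x i y) f = partial x i f y.
Proof.
move=> oU Uy xy sf.
have -> : partial x i f y =
    'D_(delta_mx 0 i) ((f \o cinv y) \o (cmap y \o cinv x)) (cmap x y).
  apply: near_eq_derive.
  apply: (near_chart xy (P := fun z => f z = f (cinv y (cmap y z)))).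
  by apply: filterS (near_open_set (cdom_open y) (cdomxx y)) => z yz /=; rewrite cmapK.
have e : cinv x (cmap x y) = y by rewrite cmapK.
rewrite derive_comp_row /= ?e//; first last.
  by move=> j; exact: smooth_differentiable (cdomxx y) xy (@smooth_coord y j).
  exact: smooth_differentiable (cdomxx y) sf.
rewrite /dirder derive_rowE; last exact: smooth_differentiable (cdomxx y) sf.
by apply: eq_bigr => j _; rewrite mxE.
Qed.

Lemma dirder_sum_coordv x y U (c : 'I_m -> R) f :
  open U -> U y -> cdom x y -> smooth_on U f ->
  dirder y (\sum_i c i *: (coordv x i y : 'rV[R]_m)) f = \sum_i c i * partial x i f y.
Proof.
move=> oU Uy xy sf; rewrite (dirder_sumv Uy)//; apply: eq_bigr => i _.
by rewrite (dirderZv Uy)// (dirder_coordv i oU Uy xy sf).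
Qed.

Lemma partial_coord x y i j : cdom x y ->
  partial x i (fun z => cmap x z 0 j) y = (i == j)%:R.
Proof.
move=> xy; rewrite /partial.
have -> : 'D_(delta_mx 0 i) ((fun z => cmap x z 0 j) \o cinv x) (cmap x y) =
    'D_(delta_mx 0 i) (fun a : 'rV[R]_m => a 0 j) (cmap x y).
  have xa : (cmap x @` cdom x) (cmap x y) by exists y.
  apply: near_eq_derive; apply: filterS (near_open_set (@cimg_open x) xa).
  by move=> a /cinvK /= ->.
by rewrite derive_coord mxE eqxx eq_sym.
Qed.

Lemma dirder_coord x v j : dirder x v (fun z => cmap x z 0 j) = v 0 j.
Proof.
have xa : (cmap x @` cdom x) (cmap x x) by exists x => //; exact: cdomxx.
rewrite -(derive_coord j v (cmap x x)); apply: near_eq_derive.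
apply: filterS (near_open_set (@cimg_open x) xa) => a.
by move=> /cinvK /= ->.
Qed.

Lemma tangent_eq x v w :
  (forall j, dirder x v (fun z => cmap x z 0 j) = dirder x w (fun z => cmap x z 0 j)) ->
  v = w.
Proof. by move=> e; apply/rowP => j; rewrite -(dirder_coord x v) -(dirder_coord x w). Qed.

Lemma tangent_expand x y v : cdom x y ->
  v = \sum_j dirder y v (fun z => cmap x z 0 j) *: coordv x j y :> 'rV[R]_m.
Proof.
move=> xy; apply: (@tangent_eq y) => j.
have oy := @cdom_open y; have yy := cdomxx y; have sy := @smooth_coord y j.
rewrite (dirder_sumv yy)// (dirder_partial v oy yy xy sy).
apply: eq_bigr => i _; rewrite (dirderZv yy)//.
by rewrite (dirder_coordv _ oy yy xy).
Qed.

(** Applied to the coordinates of the chart [x], a vector field gives exactly its coefficients in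
    the frame [coordv x]. *)
Lemma smooth_vectorP U (V : section (tangent M)) : open U ->
  smooth_section_on U V <->
  (forall x j, smooth_on (U `&` cdom x) (fun y => dirder y (V y) (fun z => cmap x z 0 j))).
Proof.
move=> oU; split=> [sV x j|sV x].
  have [c [sc Vc]] := sV x.
  apply: smooth_eq (sc j); first by apply: openI => //; exact: cdom_open.
  move=> y; rewrite inE => -[Uy xy].
  rewrite (Vc y (conj Uy xy)) [RHS](dirder_sum_coordv _ (@cdom_open x) xy xy (@smooth_coord x j)).
  rewrite (bigD1 j isT) /= partial_coord// eqxx mulr1 big1 ?addr0// => i ij.
  by rewrite partial_coord// (negbTE ij) mulr0.
exists (fun j y => dirder y (V y) (fun z => cmap x z 0 j)); split=> [j|y [_ xy]].
  exact: sV.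
exact: tangent_expand.
Qed.

Lemma smooth_dirder U (V : section (tangent M)) f : open U ->
  smooth_section_on U V -> smooth_on U f -> smooth_on U (fun y => dirder y (V y) f).
Proof.
move=> oU sV sf; apply: smooth_local => x Ux; exists (U `&` cdom x).
  by split=> //; exact: cdomxx.
have oUx : open (U `&` cdom x) by apply: openI => //; exact: cdom_open.
apply: (@smooth_eq _ (fun y => \sum_j dirder y (V y) (fun z => cmap x z 0 j)
   * partial x j f y)) => //.
  by move=> y; rewrite inE => -[Uy xy]; rewrite -(dirder_partial _ oU Uy xy sf).
apply: smooth_sum => // j; apply: smooth_mul => //; last exact: smooth_partial.
by have /smooth_vectorP := sV; exact.
Qed.

Lemma partialC x y U i j f : open U -> U y -> cdom x y -> smooth_on U f ->
  partial x i (partial x j f) y = partial x j (partial x i f) y.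
Proof.
move=> oU Uy xy sf.
pose F := f \o cinv x; pose D := cmap x @` (U `&` cdom x).
have oD : open D by exact: chart_open.
have Dy : D (cmap x y) by exists y.
have E k l : partial x k (partial x l f) y =
    'D_(delta_mx 0 k) (fun a => 'D_(delta_mx 0 l) F a) (cmap x y).
  apply: near_eq_derive; apply: filterS (near_open_set oD Dy) => a.
  by move=> /cimgP[/cinvK /= + _]; rewrite /partial => ->.
have [dF pF] := sf x 2%N.
rewrite !E; apply: (derive_sym oD Dy).
- exact: dF.
- by have [+ _] := pF i; exact.
- by have [+ _] := pF j; exact.
- by have [_ /(_ i)] := pF j; apply.
- by have [_ /(_ j)] := pF i; apply.
Qed.

(** By definition this holds for the coordinates of the chart at [x]. For general [f], [D2]
    separates the terms with first partials of [f] from a double sum of second partials, which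
    cancels in the commutator. *)
Lemma vbracketE (V W : section (tangent M)) U x f : open U -> U x ->
  smooth_section_on U V -> smooth_section_on U W -> smooth_on U f ->
  dirder x (vbracket V W x) f =
  dirder x (V x) (fun y => dirder y (W y) f) -
  dirder x (W x) (fun y => dirder y (V y) f).
Proof.
move=> oU Ux; have oUx : open (U `&` cdom x) by apply: openI => //; exact: cdom_open.
have xx := cdomxx x; have Uxx : (U `&` cdom x) x by [].
have cj (V' : section (tangent M)) j : smooth_section_on U V' -> smooth_on (U `&` cdom x)
   (fun y => dirder y (V' y) (fun z => cmap x z 0 j)).
  by move=> /smooth_vectorP; exact.
have D2 (V' W' : section (tangent M)) :
  smooth_section_on U V' -> smooth_section_on U W' -> smooth_on U f ->
  dirder x (V' x) (fun y => dirder y (W' y) f) =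
  \sum_j dirder x (V' x) (fun y => dirder y (W' y) (fun z => cmap x z 0 j)) *
    partial x j f x +
  \sum_j \sum_i W' x 0 j * V' x 0 i * partial x i (partial x j f) x.
  move=> sV sW sf.
  have sp j : smooth_on (U `&` cdom x) (partial x j f) by exact: smooth_partial.
  rewrite (@dirder_eq _ _ _ (fun y => \sum_j dirder y (W' y) (fun z => cmap x z 0 j)
   * partial x j f y)); last first.
    apply: filterS (near_open_set oUx Uxx) => y [Uy xy].
    exact: (dirder_partial _ oU Uy xy sf).
  rewrite (dirder_sum Uxx)// => [|j]; last by apply: smooth_mul => //; exact: cj.
  rewrite -big_split; apply: eq_bigr => j _ /=.
  rewrite (dirderM Uxx _ (cj W' j sW) (sp j)) [LHS]addrC dirder_coord mulrC.
  congr (_ * _ + _).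
  rewrite (dirder_partial _ oUx Uxx xx (sp j)) mulr_sumr; apply: eq_bigr => i _.
  by rewrite dirder_coord mulrA.
move=> sV sW sf.
rewrite (dirder_partial _ oU Ux xx sf) (D2 _ _ sV sW sf) (D2 _ _ sW sV sf).
(* The two second-order sums agree by the symmetry of second partials. *)
have -> : \sum_j \sum_i V x 0 j * W x 0 i * partial x i (partial x j f) x =
    \sum_j \sum_i W x 0 j * V x 0 i * partial x i (partial x j f) x.
  rewrite exchange_big; apply: eq_bigr => j _; apply: eq_bigr => i _.
  have -> := partialC i j oU Ux xx sf.
  by congr (_ * _); rewrite mulrC.
have aux (a b c : R) : (a + c) - (b + c) = a - b by ring.
rewrite [RHS]aux -sumrB; apply: eq_bigr => j _.
by rewrite dirder_coord mxE mulrBl.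
Qed.

Lemma smooth_vbracket U (V W : section (tangent M)) : open U ->
  smooth_section_on U V -> smooth_section_on U W -> smooth_section_on U (vbracket V W).
Proof.
move=> oU sV sW; apply/smooth_vectorP => // x j.
have oUx : open (U `&` cdom x) by apply: openI => //; exact: cdom_open.
have sc : smooth_on (U `&` cdom x) (fun z => cmap x z 0 j).
  by apply: smooth_sub (@smooth_coord x j) => y [].
have sub (V' : section (tangent M)) : smooth_section_on U V' -> smooth_section_on (U `&` cdom x) V'.
  move=> sV' i; have [c [sc' Vc]] := sV' i; exists c; split=> [k|y [[Uy _] iy]].
    by apply: smooth_sub (sc' k) => y [[? _] ?].
  exact: Vc.
have sV' := sub _ sV; have sW' := sub _ sW.
apply: (@smooth_eq _ (fun y => dirder y (V y) (fun z => dirder z (W z) (fun t => cmap x t 0 j))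
  - dirder y (W y) (fun z => dirder z (V z) (fun t => cmap x t 0 j)))) => //.
  by move=> y; rewrite inE => Uxy; rewrite (vbracketE oUx Uxy).
by apply: smooth_add => //; [|apply: smooth_opp => //]; do 2 apply: smooth_dirder => //.
Qed.

Lemma vbracket_jacobi (V W Z : section (tangent M)) x :
  smooth_section V -> smooth_section W -> smooth_section Z ->
  vbracket (vbracket V W) Z x = vbracket V (vbracket W Z) x - vbracket W (vbracket V Z) x.
Proof.
move=> sV sW sZ; apply: (@tangent_eq x) => j.
have ox := @cdom_open x; have xx := cdomxx x; have sc := @smooth_coord x j.
set u := fun z => cmap x z 0 j in sc *.
have sub (V' : section (tangent M)) : smooth_section V' -> smooth_section_on (cdom x) V'.
  move=> sV' i; have [c [sc' Vc]] := sV' i; exists c; split=> [k|y [_ iy]].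
    by apply: smooth_sub (sc' k) => y [_ ?].
  exact: Vc.
move: sV sW sZ => /sub sV /sub sW /sub sZ.
have sb (V' W' : section (tangent M)) :
  smooth_section_on (cdom x) V' -> smooth_section_on (cdom x) W' ->
  smooth_section_on (cdom x) (vbracket V' W') by exact: smooth_vbracket.
have sd (V' : section (tangent M)) f : smooth_section_on (cdom x) V' -> smooth_on (cdom x) f ->
  smooth_on (cdom x) (fun y => dirder y (V' y) f) by exact: smooth_dirder.
have bE (V' W' : section (tangent M)) f :
  smooth_section_on (cdom x) V' -> smooth_section_on (cdom x) W' ->
  smooth_on (cdom x) f -> dirder x (vbracket V' W' x) f =
  dirder x (V' x) (fun y => dirder y (W' y) f) -
  dirder x (W' x) (fun y => dirder y (V' y) f) by exact: vbracketE.
have bE2 v (V' W' : section (tangent M)) :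
  smooth_section_on (cdom x) V' -> smooth_section_on (cdom x) W' ->
  dirder x v (fun y => dirder y (vbracket V' W' y) u) =
  dirder x v (fun y => dirder y (V' y) (fun z => dirder z (W' z) u)) -
  dirder x v (fun y => dirder y (W' y) (fun z => dirder z (V' z) u)).
  move=> sV' sW'; rewrite -(dirderB xx)//; [|by apply: (sd) => //; exact: sd..].
  apply: dirder_eq; apply: filterS (near_open_set ox xx) => y xy.
  exact: (vbracketE ox).
(* Tested on a coordinate function [u], every iterated bracket is a signed sum of four triple
   derivatives; the identity is then formal. *)
pose d3 (A B C : section (tangent M)) :=
  dirder x (A x) (fun y => dirder y (B y) (fun z => dirder z (C z) u)).
have T1 A B C : smooth_section_on (cdom x) A -> smooth_section_on (cdom x) B ->
    smooth_section_on (cdom x) C -> dirder x (vbracket (vbracket A B) C x) u =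
    (d3 A B C - d3 B A C) - (d3 C A B - d3 C B A).
  move=> sA sB sC; have -> := bE _ _ _ (sb _ _ sA sB) sC sc.
  by have -> := bE _ _ _ sA sB (sd _ _ sC sc); have -> := bE2 (C x) _ _ sA sB.
have T2 A B C : smooth_section_on (cdom x) A -> smooth_section_on (cdom x) B ->
    smooth_section_on (cdom x) C -> dirder x (vbracket A (vbracket B C) x) u =
    (d3 A B C - d3 A C B) - (d3 B C A - d3 C B A).
  move=> sA sB sC; have -> := bE _ _ _ sA (sb _ _ sB sC) sc.
  by have -> := bE _ _ _ sB sC (sd _ _ sA sc); have -> := bE2 (A x) _ _ sB sC.
have aux (v w : 'rV[R]_m) : dirder x (v - w) u = dirder x v u - dirder x w u.
  by rewrite (dirderDv xx)// -scaleN1r (dirderZv xx)// mulN1r.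
apply: (etrans (T1 _ _ _ sV sW sZ)); apply/esym; apply: (etrans (aux _ _)).
have e1 := T2 _ _ _ sV sW sZ; have e2 := T2 _ _ _ sW sV sZ.
apply: (etrans (f_equal2 (fun s t => s - t) e1 e2)).
by clear; clearbody d3; ring.
Qed.

End Charts.

(** * Sections of vector bundles *)

#[local] Opaque dirder.

Section Bump.
Context {R : realType} {m : nat} {M : charted R m}.
Hypothesis HM : has_atlas M.
Implicit Types (x y : M) (U K : set M) (b f : M -> R).

(** [U] and the complement of the closed set [K] form an open cover of [M]. Local data on [U]
    multiplied by [b] is smooth on the first set and zero on the second, hence extends to [M]. *)
Definition is_bump x U b : Prop := [/\ smooth_on setT b, b x = 1 &
  exists K : set M, [/\ closed K, K `<=` U & forall y, ~ K y -> b y = 0]].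

Lemma bump_exists x U : open U -> U x -> exists b, is_bump x U b.
Proof.
move=> oU Ux; have xx := cdomxx HM x.
have oD := @chart_open _ _ _ HM x _ oU.
have Dx : (cmap x @` (U `&` cdom x)) (cmap x x) by exists x.
have [r /= r0 rD] := (@nbhs_ballP _ _ _ _).1 (open_nbhs_nbhs (conj oD Dx)).
have [be [K0 [sbe be0 cK0 K0r beK0]]] := ball_bump (cmap x x) r0.
have K0D a : K0 a -> (cmap x @` (U `&` cdom x)) a by move=> /K0r/rD.
pose K := cinv x @` K0.
(* A continuous image of a compact set is compact, hence closed since [M] is Hausdorff. The
   extension of [b] by zero is smooth for this reason. *)
have cK : closed K.
  apply: compact_closed; first by case: HM.
  apply: continuous_compact => //; apply: continuous_in_subspaceT => a.
  by rewrite inE => /K0D/(cimgP HM)[xa _]; exact: cinv_continuous.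
have KU y : K y -> (U `&` cdom x) y.
  by move=> [a /K0D/(cimgP HM)[xa Ua] <-]; split=> //; exact: cinv_cdom.
pose b y := if `[< cdom x y >] then be (cmap x y) else 0.
have bK y : ~ K y -> b y = 0.
  move=> nKy; rewrite /b; case: asboolP => // xy; apply: beK0 => Ky.
  by apply: nKy; exists (cmap x y) => //; rewrite (cmapK HM).
have bx : b x != 0 by rewrite /b asboolT// gt_eqF.
have sb : smooth_on setT b.
  apply: smooth_local => y _; have [xy|nxy] := pselect (cdom x y).
    exists (cdom x) => //; apply: (@smooth_chart _ _ _ HM x _ _ (@cdom_open _ _ _ HM x)) => // k.
    rewrite setIid; apply: (Ck_eq _ _ (Ck_sub _ (sbe k))) => //.
      exact: cimg_open.
    by move=> a; rewrite inE => xa /=; rewrite /b asboolT ?(cinvK HM)//; exact: cinv_cdom.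
  exists (~` K); first by move=> /KU[].
  apply: (smooth_eq HM _ _ (smooth_cst _ 0)); first exact: closed_openC.
  by move=> z; rewrite inE => /bK ->.
exists (fun y => (b x)^-1 * b y); split; last 1 first.
- by exists K; split=> // [y /KU[]//|y /bK ->]; rewrite mulr0.
- by apply: smooth_mul => //; [exact: openT|exact: smooth_cst].
- by rewrite mulVf.
Qed.

Lemma bump_fun x U b f : open U -> is_bump x U b -> smooth_on U f ->
  smooth_on setT (fun y => b y * f y).
Proof.
move=> oU [sb _ [K [cK KU bK]]] sf; apply: smooth_local => y _.
have [Uy|nUy] := pselect (U y).
  by exists U => //; apply: smooth_mul => //; exact: smooth_sub sb.
exists (~` K); first by move=> /KU.
apply: (smooth_eq HM _ _ (smooth_cst _ 0)); first exact: closed_openC.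
by move=> z; rewrite inE => /bK ->; rewrite mul0r.
Qed.

End Bump.

Section Bundle.
Context {R : realType} {m : nat} {M : charted R m} {n : nat} {E : vbundle M n}.
Hypothesis HM : has_atlas M.
Hypothesis HE : is_vbundle E.
Implicit Types (x y : M) (U : set M) (s t : section E) (i : fidx E) (k : 'I_n).

Definition fcoord i k x (v : E x) : R := coord [tuple frame i l x | l < n] k v.

Lemma fdom_open i : open (fdom i). Proof. by case: HE. Qed.
Lemma fdom_cover x : exists i, fdom i x. Proof. by case: HE. Qed.
Lemma frame_basis i x : fdom i x -> basis_of fullv [tuple frame i k x | k < n].
Proof. by case: HE => _ _ + _; exact. Qed.

Lemma frame_expand i x (v : E x) : fdom i x ->
  v = \sum_k fcoord i k v *: frame i k x.
Proof.
move=> /frame_basis b; rewrite {1}(coord_basis b (memvf v)).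
by apply: eq_bigr => k _; rewrite -tnth_nth tnth_mktuple.
Qed.

Lemma fcoord_sum i k x (c : 'I_n -> R) : fdom i x ->
  fcoord i k (\sum_l c l *: frame i l x) = c k.
Proof.
move=> /frame_basis/basis_free f; rewrite /fcoord.
under eq_bigr => l _ do rewrite -[frame i l x](tnth_mktuple (fun l => frame i l x)) (tnth_nth 0).
by rewrite coord_sum_free.
Qed.

Lemma fcoord_is_linear i k x : linear (@fcoord i k x : E x -> R^o).
Proof. by move=> a u v; rewrite /fcoord linearP. Qed.

HB.instance Definition _ i k x := GRing.isLinear.Build R (E x) R^o _ _ (@fcoord_is_linear i k x).

Lemma smooth_sectionP U s : open U -> smooth_section_on U s <->
  (forall i k, smooth_on (U `&` fdom i) (fun x => fcoord i k (s x))).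
Proof.
move=> oU; split=> [ss i k|ss i]; last first.
  by exists (fun k x => fcoord i k (s x)); split=> [//|x [_ ix]]; exact: frame_expand.
have [c [sc sE]] := ss i.
apply: (smooth_eq HM _ _ (sc k)); first by apply: openI => //; exact: fdom_open.
by move=> x; rewrite inE => ix; rewrite (sE x ix) fcoord_sum//; case: ix.
Qed.

Let oUi U i : open U -> open (U `&` fdom i).
Proof. by move=> oU; apply: openI => //; exact: fdom_open. Qed.

Lemma smooth_section_local s :
  (forall x, exists U : set M, [/\ open U, U x & smooth_section_on U s]) ->
  smooth_section s.
Proof.
move=> H; apply/(smooth_sectionP _ openT) => i k; rewrite setTI.
apply: smooth_local => x ix; have [U [oU Ux /(smooth_sectionP _ oU) sU]] := H x.
by exists (U `&` fdom i).
Qed.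

Lemma smooth_section_eq U s t : open U -> (forall x, U x -> s x = t x) -> smooth_section_on U s ->
  smooth_section_on U t.
Proof.
move=> oU st ss i; have [c [sc sE]] := ss i; exists c; split=> // x ix.
by rewrite -st ?sE//; case: ix.
Qed.

Lemma eq_section s t : (forall x, s x = t x) -> s = t.
Proof. exact: functional_extensionality_dep. Qed.

Lemma smooth_section_add U s t : open U -> smooth_section_on U s ->
  smooth_section_on U t -> smooth_section_on U (fun x => s x + t x).
Proof.
move=> oU /(smooth_sectionP _ oU) ss /(smooth_sectionP _ oU) st.
apply/(smooth_sectionP _ oU) => i k; under eq_fun do rewrite linearD.
exact: (smooth_add HM (oUi i oU) (ss i k) (st i k)).
Qed.

Lemma smooth_section_scale U s (f : M -> R) : open U -> smooth_on U f ->
  smooth_section_on U s -> smooth_section_on U (fun x => f x *: s x).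
Proof.
move=> oU sf /(smooth_sectionP _ oU) ss.
apply/(smooth_sectionP _ oU) => i k; under eq_fun do rewrite linearZ.
apply: (smooth_mul HM _ _ (ss i k)); first exact: oUi.
by apply: smooth_sub sf => x [].
Qed.

Lemma smooth_section0 U : open U -> smooth_section_on U (fun x => 0 : E x).
Proof.
move=> oU; apply/(smooth_sectionP _ oU) => i k; under eq_fun do rewrite linear0.
exact: smooth_cst.
Qed.

Lemma smooth_section_sum (I : Type) (r : seq I) U (F : I -> section E) : open U ->
  (forall j, smooth_section_on U (F j)) ->
  smooth_section_on U (fun x => \sum_(j <- r) F j x).
Proof.
move=> oU sF; elim: r => [|j r IH].
  by apply: (smooth_section_eq oU _ (smooth_section0 oU)) => x _; rewrite big_nil.
apply: (smooth_section_eq oU _ (smooth_section_add oU (sF j) IH)) => x _.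
by rewrite big_cons.
Qed.

Lemma smooth_frame i k : smooth_section_on (fdom i) (frame i k).
Proof. by case: HE. Qed.

Lemma bump_section x U b s : open U -> is_bump x U b -> smooth_section_on U s ->
  smooth_section (fun y => b y *: s y).
Proof.
move=> oU [sb _ [K [cK KU bK]]] ss; apply: smooth_section_local => y.
have [Uy|nUy] := pselect (U y).
  by exists U; split=> //; apply: smooth_section_scale => //; exact: smooth_sub sb.
have oK : open (~` K) by exact: closed_openC.
exists (~` K); split=> //; first by move=> /KU.
apply: (smooth_section_eq oK _ (smooth_section0 oK)) => z /bK ->.
by rewrite scale0r.
Qed.

Lemma section_through x (v : E x) : exists s, smooth_section s /\ s x = v.
Proof.
have [i ix] := fdom_cover x; have oi := fdom_open i.
have [b bP] := bump_exists HM oi ix; have [_ bx _] := bP.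
exists (fun y => b y *: \sum_k fcoord i k v *: frame i k y); split.
  apply: (bump_section oi bP); apply: smooth_section_sum => // k.
  by apply: smooth_section_scale => //; [exact: smooth_cst|exact: smooth_frame].
by rewrite bx scale1r -frame_expand.
Qed.

(** Supplies the covector that [lie_covector] selects: an operator linear over smooth functions sees
    only the value of a section at [x]. The candidate [beta] is read off from [T] on the frame
    multiplied by a bump function. *)
Lemma tensorial x (T : section E -> R) :
  (forall s t, smooth_section s -> smooth_section t ->
    T (fun y => s y + t y) = T s + T t) ->
  (forall f s, smooth_on setT f -> smooth_section s ->
    T (fun y => f y *: s y) = f x * T s) ->
  exists beta : 'Hom(E x, R^o), forall s, smooth_section s -> T s = beta (s x).
Proof.
move=> TD TZ; have [i ix] := fdom_cover x; have oi := fdom_open i.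
have [b bP] := bump_exists HM oi ix; have [sb bx _] := bP.
pose e k : section E := fun y => b y *: frame i k y.
have se k : smooth_section (e k) by apply: (bump_section oi bP); exact: smooth_frame.
pose g (v : E x) : R^o := \sum_k fcoord i k v * T (e k).
have gl : linear g.
  move=> a u v; rewrite /g scaler_sumr -big_split; apply: eq_bigr => k _ /=.
  by rewrite linearP mulrDl scalerAl.
pose gL := HB.pack g (GRing.isLinear.Build R (E x) R^o _ _ gl) : {linear E x -> R^o}.
exists (linfun gL) => s ss.
have T0 : T (fun y => 0) = 0.
  have := TZ (fun=> 0) _ (smooth_cst _ 0) (smooth_section0 openT).
  rewrite mul0r => e0; rewrite -[RHS]e0; congr T.
  by apply: eq_section => y; rewrite scale0r.
have Tsum (r : seq 'I_n) (F : 'I_n -> section E) : (forall k, smooth_section (F k)) ->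
    T (fun y => \sum_(k <- r) F k y) = \sum_(k <- r) T (F k).
  move=> sF; elim: r => [|k r IH].
    by rewrite big_nil -[RHS]T0; congr T; apply: eq_section => y; rewrite big_nil.
  rewrite big_cons -IH -TD//; last exact: smooth_section_sum openT sF.
  by congr T; apply: eq_section => y; rewrite big_cons.
pose c k y := b y * fcoord i k (s y).
have sc k : smooth_on setT (c k).
  apply: (bump_fun HM oi bP).
  by have /(smooth_sectionP _ openT)/(_ i k) := ss; rewrite setTI.
have bb : smooth_on setT (fun y => b y * b y) by apply: (smooth_mul HM _ sb sb); exact: openT.
(* [b ^ 2 s] has global coefficients [b s_k] on the global sections [b e_k] *)
transitivity (T (fun y => (b y * b y) *: s y)).
  by rewrite TZ// bx !mul1r.
transitivity (T (fun y => \sum_k c k y *: e k y)).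
  congr T; apply: eq_section => y; have [iy|niy] := pselect (fdom i y).
    rewrite {1}(frame_expand (s y) iy) scaler_sumr; apply: eq_bigr => k _.
    by rewrite /c /e !scalerA; congr (_ *: _); ring.
  have by0 : b y = 0.
    by have [_ _ [K [_ Ki bK]]] := bP; apply: bK => /Ki.
  by rewrite by0 mul0r scale0r big1// => k _; rewrite /c by0 mul0r scale0r.
rewrite Tsum => [|k]; last exact: smooth_section_scale openT (sc k) (se k).
rewrite lfunE /= /g; apply: eq_bigr => k _.
by rewrite TZ// /c bx mul1r.
Qed.

End Bundle.

(** * Alternating forms *)

Section Alternating.
Context {R : realType} {n : nat}.
Implicit Types (V : vectType R) (i j k : 'I_n).

Lemma eq_alternating V (w : ('I_n -> V) -> R) v v' : v =1 v' -> w v = w v'.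
Proof. by move=> /funext ->. Qed.

(** Polarization: [v i + v j] is put in both slots [i] and [j], and the vanishing value is
    expanded. *)
Lemma alternating_swap V (w : ('I_n -> V) -> R) v i j : Defs.alternating w -> i != j ->
  w (v \o tperm i j) = - w v.
Proof.
move=> [wL w0] ij.
pose u a b : 'I_n -> V := [eta [eta v with i |-> a] with j |-> b].
have uij a : u a a i = u a a j by rewrite /u /= eqxx (negbTE ij) eqxx.
have wl a a' b : w (u (a + a') b) = w (u a b) + w (u a' b).
  have ucomm c : u c b = [eta [eta v with j |-> b] with i |-> c].
    apply/funext => k; rewrite /u /=; case: eqP => [->|//].
    by rewrite eq_sym (negbTE ij).
  by rewrite !ucomm -[a]scale1r wL mul1r scale1r.
have wr a b b' : w (u a (b + b')) = w (u a b) + w (u a b').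
  by rewrite /u -[b]scale1r wL mul1r scale1r.
have := w0 _ _ _ ij (uij (v i + v j)).
rewrite wl !wr (w0 _ _ _ ij (uij (v i))) (w0 _ _ _ ij (uij (v j))) add0r addr0.
have -> : u (v i) (v j) = v.
  by apply/funext => k; rewrite /u /=; case: eqP => [->//|_]; case: eqP => [->|].
have -> : u (v j) (v i) = v \o tperm i j.
  apply/funext => k; rewrite /u /=; case: eqP => [->|kj]; first by rewrite tpermR.
  case: eqP => [->|ki]; first by rewrite tpermL.
  by rewrite tpermD//; apply/eqP => e; [apply: ki|apply: kj].
by move=> /eqP; rewrite addrC addr_eq0 => /eqP.
Qed.

(** Only the vanishing is carried along a product of transpositions, so no sign has to be
    tracked. *)
Lemma alternating_perm0 V (w : ('I_n -> V) -> R) v (s : 'S_n) : Defs.alternating w ->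
  w v = 0 -> w (v \o s) = 0.
Proof.
move=> wA w0; have [ts -> ] := prod_tpermP s.
elim: ts => [_|[i j] ts IH /= /andP[ij /IH {}IH]].
  by rewrite big_nil (_ : v \o _ = v)//; apply/funext => k /=; rewrite perm1.
rewrite big_cons (_ : v \o _ = (v \o (\prod_(t <- ts) tperm t.1 t.2)%g) \o tperm i j).
  by rewrite alternating_swap// IH oppr0.
by apply/funext => k /=; rewrite permM.
Qed.

(** Expanding every argument leaves tuples of basis vectors: a tuple with a repetition gives 0, and
    one without is a permutation of the standard basis. *)
Lemma alternating_eq0 (w : ('I_n -> 'rV[R]_n) -> R) : Defs.alternating w ->
  w (fun k => delta_mx 0 k) = 0 -> forall v, w v = 0.
Proof.
move=> wA w0.
(* induction on the number of arguments which may not be basis vectors *)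
suff H (q : nat) : forall v, (forall k, (q <= k)%N -> exists l, v k = delta_mx 0 l) ->
    w v = 0.
  by move=> v; apply: (H n) => k; rewrite leqNgt ltn_ord.
elim: q => [|q IH] v vq.
  have /choice[f fv] : forall k, exists l, v k = delta_mx 0 l by move=> k; exact: vq.
  have [/injectiveP fi|/injectivePn[i [j ij fij]]] := boolP (injectiveb f).
    rewrite (_ : v = (fun k => delta_mx 0 k) \o perm fi); first exact: alternating_perm0.
    by apply/funext => k /=; rewrite permE.
  by have [_ wz] := wA; apply: (wz _ i j) => //; rewrite !fv fij.
have [qn|nq] := ltnP q n; last first.
  by apply: IH => k kq; have := leq_ltn_trans kq (ltn_ord k); rewrite ltnNge nq.
pose i := Ordinal qn.
have -> : v = [eta v with i |-> \sum_l v i 0 l *: delta_mx 0 l].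
  by apply/funext => k /=; case: eqP => [->|//]; rewrite -row_sum_delta.
have [wL _] := wA.
have wi0 : w [eta v with i |-> 0] = 0.
  have := wL v i (-1) 0 0; rewrite scaleN1r oppr0 addr0 => ->.
  by rewrite mulN1r addNr.
have wi l : w [eta v with i |-> delta_mx 0 l] = 0.
  apply: IH => k; rewrite leq_eqVlt => /orP[/eqP qk|qk] /=.
    by rewrite (_ : k = i) ?eqxx; [exists l|apply: val_inj].
  have [l' ->] := vq k qk; case: eqP => _; [by exists l|by exists l'].
elim: (index_enum _) => [|l r IHr]; first by rewrite big_nil.
by rewrite big_cons wL wi mulr0 add0r.
Qed.

(** The difference [G] of the two sides, as a function of the rows of coefficients, is alternating
    and vanishes on the standard basis, hence vanishes everywhere. *)
Lemma alternating_det V (w : ('I_n -> V) -> R) (e : 'I_n -> V) (C : 'M[R]_n) :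
  Defs.alternating w -> w (fun k => \sum_l C k l *: e l) = \det C * w e.
Proof.
move=> [wL w0].
pose mx (v : 'I_n -> 'rV[R]_n) : 'M[R]_n := \matrix_(k, l) v k 0 l.
pose ev (v : 'I_n -> 'rV[R]_n) : 'I_n -> V := fun k => \sum_l v k 0 l *: e l.
pose G v := w (ev v) - \det (mx v) * w e.
have evE v i a : ev [eta v with i |-> a] = [eta ev v with i |-> \sum_l a 0 l *: e l].
  by apply/funext => k; rewrite /ev /=; case: eqP.
have GA : Defs.alternating G; first split.
- move=> v i a u u'; rewrite /G !evE.
  have -> : \sum_l (a *: u + u') 0 l *: e l =
      a *: (\sum_l u 0 l *: e l) + \sum_l u' 0 l *: e l.
    rewrite scaler_sumr -big_split; apply: eq_bigr => l _ /=.
    by rewrite !mxE scalerDl scalerA.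
  rewrite wL.
  have -> : \det (mx [eta v with i |-> a *: u + u']) =
      a * \det (mx [eta v with i |-> u]) + 1 * \det (mx [eta v with i |-> u']).
    apply: (@determinant_multilinear _ _ _ _ _ i).
    - by apply/rowP => l; rewrite !mxE /= eqxx !mxE mul1r.
    - by apply/matrixP => k l; rewrite !mxE /= eq_sym (negbTE (neq_lift _ _)).
    - by apply/matrixP => k l; rewrite !mxE /= eq_sym (negbTE (neq_lift _ _)).
  ring.
- move=> v i j ij vij; rewrite /G (w0 _ i j ij) /ev ?vij//.
  rewrite (determinant_alternate ij) ?mul0r ?subrr// => l.
  by rewrite !mxE vij.
have G0 : G (fun k => delta_mx 0 k) = 0.
  rewrite /G (_ : mx _ = 1%:M) ?det1 ?mul1r; last first.
    by apply/matrixP => k l; rewrite !mxE eqxx eq_sym.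
  rewrite (_ : ev _ = e) ?subrr//; apply/funext => k; rewrite /ev (bigD1 k)//=.
  rewrite mxE !eqxx scale1r big1 ?addr0// => l lk.
  by rewrite mxE (negbTE lk) andbF scale0r.
have /eqP := alternating_eq0 GA G0 (fun k => row k C).
rewrite /G subr_eq0 => /eqP E; transitivity (w (ev (fun k => row k C))).
  by apply: eq_alternating => k; apply: eq_bigr => l _; rewrite mxE.
by rewrite E; congr (\det _ * _); apply/matrixP => k l; rewrite !mxE.
Qed.

Section Basis.
Variables (V : vectType R) (e : n.-tuple V).
Hypothesis eB : basis_of fullv e.

Lemma alternating_basis (w : ('I_n -> V) -> R) v : Defs.alternating w ->
  w v = \det (\matrix_(k, l) coord e l (v k)) * w (tnth e).
Proof.
move=> wA; rewrite -alternating_det//; apply: eq_alternating => k.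
rewrite [LHS](coord_basis eB (memvf _)); apply: eq_bigr => l _.
by rewrite mxE (tnth_nth 0).
Qed.

Lemma alternating_basis_neq0 (w : ('I_n -> V) -> R) v : Defs.alternating w ->
  w v != 0 -> w (tnth e) != 0.
Proof.
by move=> wA; apply: contra_neq => we0; rewrite alternating_basis// we0 mulr0.
Qed.

Lemma alternating_ratio (w w' : ('I_n -> V) -> R) v : Defs.alternating w ->
  Defs.alternating w' -> w (tnth e) != 0 -> w' v = w' (tnth e) / w (tnth e) * w v.
Proof.
move=> wA w'A we; rewrite (alternating_basis v w'A) (alternating_basis v wA).
by rewrite [in RHS]mulrCA divfK.
Qed.

End Basis.
End Alternating.

(** * Tangent bundle, dual bundle and top forms *)

Section TangentBundle.
Context {R : realType} {m : nat} {M : charted R m}.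
Hypothesis HM : has_atlas M.

Lemma tangent_vbundle : is_vbundle (tangent M).
Proof.
split=> [x|x|x y xy|x k]; first exact: cdom_open.
- by exists x; exact: cdomxx.
- rewrite basisEdim size_tuple dimvf /= /dim /= mul1n leqnn andbT.
  apply/subvP => v _; rewrite (tangent_expand HM (v : 'rV[R]_m) xy).
  apply: memv_suml => j _; apply: memvZ; apply: memv_span.
  by apply/mapP; exists j; rewrite ?mem_enum.
- apply/(smooth_vectorP HM); first exact: cdom_open.
  move=> z j; have oz := @cdom_open _ _ _ HM z; have sz := @smooth_coord _ _ _ HM z j.
  apply: (smooth_eq HM (f := partial x k (fun t => cmap z t 0 j))).
  + by apply: openI; exact: cdom_open.
  + move=> y /set_mem[xy zy]; exact/esym/(dirder_coordv HM k oz zy xy sz).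
  + by rewrite setIC; exact: smooth_partial.
Qed.

End TangentBundle.

Section DualBundle.
Context {R : realType} {m : nat} {M : charted R m} {n : nat} {E : vbundle M n}.
Hypothesis HM : has_atlas M.
Hypothesis HE : is_vbundle E.
Implicit Types (x y : M) (U : set M) (s : section E) (al : section (dual_bundle E))
  (i : fidx E) (k : 'I_n).

Lemma dual_frameE i k x (v : E x) :
  (frame (v := dual_bundle E) i k x : 'Hom(E x, R^o)) v = fcoord i k v.
Proof. by rewrite lfunE. Qed.

Lemma dual_expand i x (a : 'Hom(E x, R^o)) : fdom i x ->
  a = \sum_k a (frame i k x) *: (frame (v := dual_bundle E) i k x : 'Hom(E x, R^o)).
Proof.
move=> ix; apply/lfunP => v; rewrite {1}(frame_expand HE v ix) linear_sum.
rewrite sum_lfunE; apply: eq_bigr => k _.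
by rewrite linearZ scale_lfunE dual_frameE [LHS]mulrC.
Qed.

Lemma dual_vbundle : is_vbundle (dual_bundle E).
Proof.
split=> [i|x|i x ix|i k]; [exact: fdom_open HE i|exact: (fdom_cover HE)| |].
- have dn : \dim (fullv : {vspace 'Hom(E x, R^o)}) = n.
    by rewrite dimvf /dim /= muln1 -dimvf (size_basis (frame_basis HE ix)).
  rewrite basisEdim size_tuple [X in (_ <= X)%N]dn leqnn andbT.
  apply/subvP => a _; rewrite (dual_expand (a : 'Hom(E x, R^o)) ix).
  apply: memv_suml => j _; apply: memvZ; apply: memv_span.
  by apply/mapP; exists j; rewrite ?mem_enum.
- move=> j; pose i' : fidx E := i; pose j' : fidx E := j.
  exists (fun l x => fcoord i' k (frame j' l x)); split=> [l|x [ix jx]].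
    rewrite setIC; have oj := fdom_open HE j'.
    by have /(smooth_sectionP HM HE _ oj) := smooth_frame HE j' l; exact.
  rewrite [LHS](dual_expand (i := j') _ jx); apply: eq_bigr => l _.
  by rewrite (dual_frameE i').
Qed.

Lemma smooth_pairing U s al : open U -> smooth_section_on U s ->
  smooth_section_on U al -> smooth_on U (fun x => al x (s x)).
Proof.
move=> oU ss sa; apply: smooth_local => x Ux.
have [i ix] := fdom_cover HE x; exists (U `&` fdom i) => //.
have [c [sc sE]] := ss i; have [d [sd aE]] := sa i.
have oi : open (U `&` fdom i) by apply: openI => //; exact: fdom_open.
apply: (smooth_eq HM (f := fun x => \sum_k d k x * c k x)) => //.
  move=> y /set_mem iy; have [_ iy'] := iy; rewrite (aE _ iy) sum_lfunE.
  apply: eq_bigr => k _; rewrite scale_lfunE dual_frameE (sE _ iy) fcoord_sum//.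
by apply: smooth_sum => // k; exact: smooth_mul.
Qed.

Lemma smooth_dualP U al : open U ->
  (forall i k, smooth_on (U `&` fdom i) (fun x => al x (frame i k x))) ->
  smooth_section_on U al.
Proof.
move=> oU sa i; pose i' : fidx E := i.
exists (fun k x => al x (frame i' k x)); split=> [k|x [_ ix]]; first exact: (sa i').
exact: (dual_expand (i := i')).
Qed.

End DualBundle.

Section TopForm.
Context {R : realType} {m : nat} {M : charted R m} {n : nat} {E : vbundle M n}.
Hypothesis HM : has_atlas M.
Hypothesis HE : is_vbundle E.

Lemma smooth_prod_fun (I : Type) (r : seq I) U (F : I -> M -> R) : open U ->
  (forall i, smooth_on U (F i)) -> smooth_on U (fun y => \prod_(i <- r) F i y).
Proof.
move=> oU sF; elim: r => [|i r IH].
  by under eq_fun do rewrite big_nil; exact: smooth_cst.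
under eq_fun do rewrite big_cons; exact: smooth_mul.
Qed.

(** In a local frame the value is the determinant of the smooth coordinates of the sections, times
    the smooth coefficient of the form. *)
Lemma smooth_top_eval U (w : top_form E) (s : 'I_n -> section E) : open U ->
  smooth_top_form w -> (forall k, smooth_section_on U (s k)) ->
  smooth_on U (fun x => w x (fun k => s k x)).
Proof.
move=> oU [wA sw] ss; apply: smooth_local => x Ux.
have [i ix] := fdom_cover HE x; exists (U `&` fdom i) => //.
have oi : open (U `&` fdom i) by apply: openI => //; exact: fdom_open.
apply: (smooth_eq HM (f := fun x => \det (\matrix_(k, l) fcoord i l (s k x)) *
   w x (fun k => frame i k x))) => //.
  move=> y /set_mem[_ iy]; rewrite -alternating_det//.
  apply: eq_alternating => k; rewrite [RHS](frame_expand HE _ iy).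
  by apply: eq_bigr => l _; rewrite mxE.
apply: smooth_mul => //; last by apply: smooth_sub (sw i) => y [].
apply: smooth_sum => // g; apply: smooth_mul => //; first exact: smooth_cst.
apply: smooth_prod_fun => // k; under eq_fun do rewrite mxE.
by have /(smooth_sectionP HM HE _ oU) := ss k; exact.
Qed.

Lemma nonvanishing_frame (w : top_form E) i x : smooth_top_form w -> nonvanishing w ->
  fdom i x -> w x (fun k => frame i k x) != 0.
Proof.
move=> [wA _] w0 ix; have [v wv] := w0 x.
have := alternating_basis_neq0 (frame_basis HE ix) (wA x) wv.
rewrite (@eq_alternating _ _ _ _ _ (fun k => frame i k x))// => k.
by rewrite tnth_mktuple.
Qed.

Lemma top_form_ratio (w w' : top_form E) i x v : smooth_top_form w -> nonvanishing w ->
  smooth_top_form w' -> fdom i x ->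
  w' x v = w' x (fun k => frame i k x) / w x (fun k => frame i k x) * w x v.
Proof.
move=> sw w0 [w'A _] ix; have wf := nonvanishing_frame sw w0 ix; have [wA _] := sw.
have e : tnth [tuple frame i k x | k < n] = fun k => frame i k x.
  by apply/funext => k; rewrite tnth_mktuple.
by have := alternating_ratio (frame_basis HE ix) (w := w x) v (wA x) (w'A x); rewrite e; exact.
Qed.

End TopForm.

(** * Modular forms are closed *)

Section LieTop.
Context {R : realType} {m : nat} {M : charted R m} {n : nat} {E : vbundle M n}.
Hypothesis HM : has_atlas M.
Hypothesis HE : is_vbundle E.
Variable w : top_form E.
Arguments w : clear implicits.
Hypothesis sw : smooth_top_form w.
Implicit Types (s : 'I_n -> section E) (V W : section (tangent M)) (x : M).

Definition top_eval s : M -> R := fun x => w x (fun k => s k x).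

(** The replacement is made on whole sections, where [lie_top] replaces a value at one point; a
    second [lie_top] can then be applied to the result. *)
Definition upd s i (t : section E) : 'I_n -> section E :=
  fun k => if k == i then t else s k.

Lemma lie_topE V de s x : lie_top V de w s x =
  dirder x (V x) (top_eval s) - \sum_i top_eval (upd s i (de (s i))) x.
Proof.
rewrite /lie_top /top_eval; congr (_ - _); apply: eq_bigr => i _; congr (w x).
by apply/funext => k; rewrite /upd /=; case: ifP.
Qed.

Lemma smooth_upd s i t : (forall k, smooth_section (s k)) -> smooth_section t ->
  forall k, smooth_section (upd s i t k).
Proof. by move=> ss st k; rewrite /upd; case: ifP. Qed.

Lemma smooth_eval s : (forall k, smooth_section (s k)) -> smooth_on setT (top_eval s).
Proof. by move=> ss; apply: (smooth_top_eval HM HE) => //; exact: openT. Qed.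

Lemma smooth_lie_top V de s : smooth_section V ->
  (forall t, smooth_section t -> smooth_section (de t)) ->
  (forall k, smooth_section (s k)) -> smooth_on setT (lie_top V de w s).
Proof.
move=> sV sde ss.
rewrite (_ : lie_top V de w s = fun x => dirder x (V x) (top_eval s) -
    \sum_i top_eval (upd s i (de (s i))) x); last first.
  by apply/funext => x; exact: lie_topE.
apply: (smooth_add HM openT).
  by apply: (smooth_dirder HM openT) => //; exact: smooth_eval.
apply: (smooth_opp HM openT); apply: (smooth_sum HM _ openT) => i.
by apply: smooth_eval; apply: smooth_upd => //; exact: sde.
Qed.

Lemma top_eval_updB s i t t' t'' x : t x = t' x - t'' x ->
  top_eval (upd s i t) x = top_eval (upd s i t') x - top_eval (upd s i t'') x.
Proof.
move=> tE; have [wL _] := sw.1 x.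
have e u : (fun k => upd s i u k x) = [eta (fun k => s k x) with i |-> u x].
  by apply/funext => k; rewrite /upd /=; case: ifP.
rewrite /top_eval !e tE addrC -scaleN1r wL mulN1r addrC; congr (_ - _).
Qed.

(* [L_V L_W w - L_W L_V w], evaluated on sections, is the Lie derivative
   for the commutators. *)
Lemma lie_top_commutator V W dV dW dVW s x :
  smooth_section V -> smooth_section W ->
  (forall t, smooth_section t -> smooth_section (dV t)) ->
  (forall t, smooth_section t -> smooth_section (dW t)) ->
  (forall t, smooth_section t -> dVW t x = dV (dW t) x - dW (dV t) x) ->
  (forall k, smooth_section (s k)) ->
  (dirder x (V x) (lie_top W dW w s) - \sum_i lie_top W dW w (upd s i (dV (s i))) x)
  - (dirder x (W x) (lie_top V dV w s) - \sum_i lie_top V dV w (upd s i (dW (s i))) x)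
  = lie_top (vbracket V W) dVW w s x.
Proof.
move=> sV sW sdV sdW dE ss.
have D (V1 V2 : section (tangent M)) d2 : smooth_section V2 ->
    (forall t, smooth_section t -> smooth_section (d2 t)) ->
    dirder x (V1 x) (lie_top V2 d2 w s) =
    dirder x (V1 x) (fun y => dirder y (V2 y) (top_eval s)) -
    \sum_i dirder x (V1 x) (top_eval (upd s i (d2 (s i)))).
  move=> sV2 sd2; have su i := smooth_eval (smooth_upd i ss (sd2 _ (ss i))).
  rewrite (_ : lie_top V2 d2 w s = fun x => dirder x (V2 x) (top_eval s) -
      \sum_i top_eval (upd s i (d2 (s i))) x); last first.
    by apply/funext => y; exact: lie_topE.
  rewrite (dirderB HM (I : setT x) _ openT); first last.
  - exact: (smooth_sum HM _ openT).
  - by apply: (smooth_dirder HM openT) => //; exact: smooth_eval.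
  by rewrite (dirder_sum HM (I : setT x))//; exact: openT.
(* The terms in which both operators reach the same slot [i] are separated from those in which they
   reach different slots. *)
have S (V2 : section (tangent M)) d1 d2 :
    \sum_i lie_top V2 d2 w (upd s i (d1 (s i))) x =
    \sum_i dirder x (V2 x) (top_eval (upd s i (d1 (s i)))) -
    (\sum_i top_eval (upd s i (d2 (d1 (s i)))) x +
     \sum_i \sum_(j | j != i)
        top_eval (upd (upd s i (d1 (s i))) j (d2 (s j))) x).
  rewrite -big_split -sumrB; apply: eq_bigr => i _; rewrite lie_topE; congr (_ - _).
  rewrite (bigD1 i)//=; congr (_ + _).
    congr (w x); apply/funext => k; rewrite /upd eqxx.
    by case: ifP => // ->.
  apply: eq_bigr => j ji; congr (w x); apply/funext => k.
  by rewrite {3}/upd (negbTE ji).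
rewrite lie_topE (vbracketE HM openT (I : setT x) sV sW (smooth_eval ss)).
rewrite D// D// S S.
(* Operators acting on different slots commute, so these terms cancel and only the terms on a single
   slot contribute to the commutator. *)
have -> : \sum_i \sum_(j | j != i) top_eval (upd (upd s i (dW (s i))) j (dV (s j))) x =
    \sum_i \sum_(j | j != i) top_eval (upd (upd s i (dV (s i))) j (dW (s j))) x.
  rewrite (exchange_big_dep predT)//=; apply: eq_bigr => j _.
  apply: eq_big => [i|i ij]; first by rewrite eq_sym.
  congr (w x); apply/funext => k; rewrite /upd.
  case: (k =P j) => [kj|_]; case: (k =P i) => [ki|_] //.
  by move: ij; rewrite -kj -ki eqxx.
have -> : \sum_i top_eval (upd s i (dVW (s i))) x =
    \sum_i top_eval (upd s i (dV (dW (s i)))) x -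
    \sum_i top_eval (upd s i (dW (dV (s i)))) x.
  by rewrite -sumrB; apply: eq_bigr => i _; apply: top_eval_updB; exact: dE.
by move: (\sum_i _) (\sum_i _) (\sum_i _) (\sum_i _) (\sum_i _) (dirder _ _ _)
  (dirder _ _ _) => *; ring.
Qed.

End LieTop.

Lemma smooth_continuous (R : realType) m (M : charted R m) U (f : M -> R) x :
  has_atlas M -> U x -> smooth_on U f -> {for x, continuous f}.
Proof.
move=> HM Ux sf; have xx := cdomxx HM x.
have xa : (cmap x @` (U `&` cdom x)) (cmap x x) by exists x.
have cf : {for cmap x x, continuous (f \o cinv x)} := sf x 0%N _ xa.
have cg : {for x, continuous ((f \o cinv x) \o cmap x)}.
  exact: (continuous_comp (cmap_continuous HM xx) cf).
suff : f @ x --> f x by [].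
have nE : \forall y \near x, ((f \o cinv x) \o cmap x) y = f y.
  apply: filterS (near_open_set (@cdom_open _ _ _ HM x) xx) => y xy /=.
  by rewrite (cmapK HM).
rewrite -[X in _ --> X](nbhs_singleton nE).
by apply: cvg_trans cg; apply: near_eq_cvg.
Qed.

Lemma smooth_neq0_open (R : realType) m (M : charted R m) (f : M -> R) :
  has_atlas M -> smooth_on setT f -> open [set y | f y != 0].
Proof.
move=> HM sf; have cf : continuous f by move=> x; exact: (smooth_continuous HM (I : setT x)).
have -> : [set y | f y != 0] = f @^-1` (~` [set 0]).
  by apply/seteqP; split=> y /= /eqP.
apply: open_comp => [x _|]; first exact: cf.
by rewrite openC; exact: closed_eq.
Qed.

(** * Lie derivatives of covector fields in a Lie algebroid *)

Section LieDerivative.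
Context {R : realType} {m : nat} {M : charted R m} {n : nat} {B : vbundle M n}
  {L : algebroid B}.
Hypothesis HM : has_atlas M.
Hypothesis HB : is_vbundle B.
Hypothesis HL : is_lie_algebroid L.
Implicit Types (X Y Z : section B) (al : section (dual_bundle B)) (x : M) (f : M -> R).

Lemma smooth_rho X : smooth_section X -> smooth_section (rho L X).
Proof. by case: HL => + _; exact. Qed.

Lemma smooth_bracket X Y : smooth_section X -> smooth_section Y ->
  smooth_section (bracket L X Y).
Proof. by case: HL => _ [+ _]; exact. Qed.

Lemma bracketC X Y x : smooth_section X -> smooth_section Y ->
  bracket L X Y x = - bracket L Y X x.
Proof. by case: HL => _ [_ [_ [+ _]]] sX sY => ->. Qed.

Lemma bracketDr X Y Z x : smooth_section X -> smooth_section Y -> smooth_section Z ->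
  bracket L X (fun y => Y y + Z y) x = bracket L X Y x + bracket L X Z x.
Proof.
move=> sX sY sZ; have sYZ := smooth_section_add HM HB openT sY sZ.
rewrite bracketC// (bracketC _ sX sY) (bracketC _ sX sZ) -opprD; congr (- _).
case: HL => _ [_ [/(_ 1 Y Z X sY sZ sX) + _]].
rewrite (_ : (fun y => 1 *: Y y + Z y) = fun y => Y y + Z y); last first.
  by apply: eq_section => y; rewrite scale1r.
by move=> ->; rewrite scale1r.
Qed.

Lemma bracketZr X Y f x : smooth_section X -> smooth_section Y -> smooth_on setT f ->
  bracket L X (fun y => f y *: Y y) x =
  f x *: bracket L X Y x + dirder x (rho L X x) f *: Y x.
Proof. by case: HL => _ [_ [_ [_ [_ [+ _]]]]] sX sY sf => ->. Qed.

Lemma rho_bracket X Y : smooth_section X -> smooth_section Y ->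
  rho L (bracket L X Y) = vbracket (rho L X) (rho L Y).
Proof. by case: HL => _ [_ [_ [_ [_ [_ +]]]]]; exact. Qed.

Lemma bracket_jacobi X Y Z x :
  smooth_section X -> smooth_section Y -> smooth_section Z ->
  bracket L (bracket L X Y) Z x =
  bracket L X (bracket L Y Z) x - bracket L Y (bracket L X Z) x.
Proof.
move=> sX sY sZ; case: HL => _ [_ [_ [_ [+ _]]]] => /(_ X Y Z sX sY sZ x).
rewrite (bracketC _ sZ (smooth_bracket sX sY)).
have -> : bracket L Y (bracket L Z X) x = - bracket L Y (bracket L X Z) x.
  have -> : bracket L Z X = fun y => (-1) *: bracket L X Z y.
    by apply: eq_section => y; rewrite scaleN1r bracketC.
  rewrite bracketZr//; [|exact: smooth_bracket|exact: smooth_cst].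
  by rewrite dirder_cst scale0r addr0 scaleN1r.
by move=> /eqP; rewrite subr_eq0 => /eqP <-.
Qed.

(** The set from which [lie_covector] chooses is inhabited: when [Y] is multiplied by [f], the
    derivative of [f] along [rho L X] comes once from the pairing and once from the bracket, with
    opposite signs. *)
Lemma lie_covectorE X al Y x : smooth_section X -> smooth_section al ->
  smooth_section Y -> lie_covector L X al x (Y x) =
  dirder x (rho L X x) (fun y => al y (Y y)) - al x (bracket L X Y x).
Proof.
move=> sX sal sY; have sp Z (sZ : smooth_section Z) := smooth_pairing HM HB openT sZ sal.
have [be beE] : exists be : 'Hom(B x, R^o), forall Z, smooth_section Z ->
    dirder x (rho L X x) (fun y => al y (Z y)) - al x (bracket L X Z x) = be (Z x).
  apply: (tensorial HM HB) => [Z Z' sZ sZ'|f Z sf sZ].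
    rewrite bracketDr// linearD.
    under eq_fun do rewrite linearD.
    rewrite (dirderD HM (I : setT x) _ (sp _ sZ) (sp _ sZ')).
    by rewrite opprD addrACA.
  rewrite bracketZr// linearD !linearZ.
  under eq_fun do rewrite linearZ.
  rewrite (dirderM HM (I : setT x) _ sf (sp _ sZ)).
  have aux (u a c d1 d2 : R) :
      u * d1 + a * d2 - (u *: (c : R^o) + d2 *: (a : R^o)) = u * (d1 - c).
    by rewrite /GRing.scale /=; ring.
  exact: aux.
have H : forall Z, smooth_section Z -> (be : dual_bundle B x) (Z x) =
    dirder x (rho L X x) (fun y => al y (Z y)) - al x (bracket L X Z x).
  by move=> Z /beE.
exact: (@xgetPex _ 0 [set be : dual_bundle B x | forall Z, smooth_section Z ->
  be (Z x) = dirder x (rho L X x) (fun y => al y (Z y)) - al x (bracket L X Z x)]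
  (ex_intro _ be H) Y sY).
Qed.

(** [lie_covectorE] speaks of global sections, while the frame is local. The frame is therefore
    multiplied by a bump function [b], and the result is divided by [b] where it does not vanish. *)
Lemma smooth_lie_covector X al : smooth_section X -> smooth_section al ->
  smooth_section (lie_covector L X al).
Proof.
move=> sX sal; apply: (smooth_dualP HB openT) => i k; rewrite setTI.
apply: smooth_local => x ix; have oi := fdom_open HB i.
have [b bP] := bump_exists HM oi ix; have [sb bx _] := bP.
pose Z : section B := fun y => b y *: frame i k y.
have sZ : smooth_section Z := bump_section HM HB oi bP (smooth_frame HB i k).
pose U := [set y | b y != 0].
have oU : open U by apply: smooth_neq0_open.
exists U; first by rewrite /U /= bx oner_neq0.
have sbU : smooth_on U b by apply: smooth_sub sb.
apply: (smooth_eq HM (f := fun y => (b y)^-1 *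
  (dirder y (rho L X y) (fun z => al z (Z z)) - al y (bracket L X Z y)))) => //.
  move=> y /set_mem by0; rewrite -lie_covectorE// linearZ.
  by rewrite [X in _ * X]/(b y * _) mulKf.
apply: (smooth_mul HM oU); first exact: (smooth_inv HM oU).
apply: (smooth_add HM oU).
  apply: (@smooth_sub _ _ _ setT) => //.
  apply: (smooth_dirder HM openT (smooth_rho sX)).
  exact: (smooth_pairing HM HB openT sZ sal).
apply: (smooth_opp HM oU); apply: (@smooth_sub _ _ _ setT) => //.
exact: (smooth_pairing HM HB openT (smooth_bracket sX sZ) sal).
Qed.

(** Evaluated on a section [Z], the mixed terms cancel. What remains is the compatibility of the
    anchor with brackets and the Jacobi identity for [X], [Y], [Z]. *)
Lemma lie_covector_bracket X Y al x : smooth_section X -> smooth_section Y ->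
  smooth_section al ->
  lie_covector L (bracket L X Y) al x =
  lie_covector L X (lie_covector L Y al) x - lie_covector L Y (lie_covector L X al) x
    :> 'Hom(B x, R^o).
Proof.
move=> sX sY sal; apply/lfunP => v; have [Z [sZ <-]] := section_through HM HB v.
have sXY := smooth_bracket sX sY.
have sLX := smooth_lie_covector sX sal; have sLY := smooth_lie_covector sY sal.
rewrite [RHS]add_lfunE opp_lfunE !lie_covectorE//; try exact: smooth_bracket.
have D (X1 X2 : section B) : smooth_section X1 -> smooth_section X2 ->
    dirder x (rho L X1 x) (fun y => lie_covector L X2 al y (Z y)) =
    dirder x (rho L X1 x) (fun y => dirder y (rho L X2 y) (fun z => al z (Z z))) -
    dirder x (rho L X1 x) (fun y => al y (bracket L X2 Z y)).
  move=> s1 s2; under eq_fun do rewrite lie_covectorE//.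
  rewrite (dirderB HM (I : setT x) _ openT)//.
    apply: (smooth_dirder HM openT (smooth_rho s2)).
    exact: (smooth_pairing HM HB openT sZ sal).
  exact: (smooth_pairing HM HB openT (smooth_bracket s2 sZ) sal).
rewrite !D// rho_bracket//.
rewrite (vbracketE HM openT (I : setT x) (smooth_rho sX) (smooth_rho sY)
  (smooth_pairing HM HB openT sZ sal)).
rewrite bracket_jacobi// linearB.
by move: (dirder _ _ _) (dirder _ _ _) (dirder _ _ _) (dirder _ _ _) => *; ring.
Qed.

End LieDerivative.

Section Cocycles.
Context {R : realType} {m : nat} {M : charted R m} {n : nat} {B : vbundle M n}
  {L : algebroid B}.
Hypothesis HM : has_atlas M.
Hypothesis HB : is_vbundle B.
Hypothesis HL : is_lie_algebroid L.

(** An exact form [df] is closed because the anchor sends brackets to brackets of vector fields, and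
    these act on [f] as commutators. *)
Lemma closed_of_exact_diff (al be : section (dual_bundle B)) (f : M -> R) :
  smooth_section al -> smooth_section be -> smooth_on setT f ->
  (forall x (v : B x), al x v - be x v = dirder x (anchor L x v) f) ->
  closed1 L al -> closed1 L be.
Proof.
move=> sal sbe sf ab cal X Y sX sY x; rewrite -(cal X Y sX sY x).
have sp Z (g : section (dual_bundle B)) : smooth_section Z -> smooth_section g ->
    smooth_on setT (fun y => g y (Z y)).
  by move=> sZ sg; exact: (smooth_pairing HM HB openT sZ sg).
have abE Z : (fun y => be y (Z y)) = fun y => al y (Z y) - dirder y (rho L Z y) f.
  by apply/funext => y; rewrite /rho -ab subKr.
have D v Z : smooth_section Z -> dirder x v (fun y => be y (Z y)) =
    dirder x v (fun y => al y (Z y)) - dirder x v (fun y => dirder y (rho L Z y) f).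
  move=> sZ; rewrite abE (dirderB HM (I : setT x) _ openT)//; first exact: sp.
  by apply: (smooth_dirder HM openT) => //; exact: smooth_rho.
have e : be x (bracket L X Y x) = al x (bracket L X Y x) -
    (dirder x (rho L X x) (fun y => dirder y (rho L Y y) f) -
     dirder x (rho L Y x) (fun y => dirder y (rho L X y) f)).
  rewrite -(vbracketE HM openT (I : setT x) (smooth_rho HL sX) (smooth_rho HL sY) sf).
  by rewrite -(rho_bracket HL sX sY) /rho -ab subKr.
rewrite e !D//.
by move: (dirder _ _ _) (dirder _ _ _) (dirder _ _ _) (dirder _ _ _) => *; ring.
Qed.

(** The nonzero values allow the factors [eta] and [mu] to be cancelled from the identity defining a
    modular form. *)
Lemma test_sections (E : vbundle M n) (w : top_form E) x : is_vbundle E ->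
  nonvanishing w -> exists s : 'I_n -> section E,
    (forall k, smooth_section (s k)) /\ top_eval w s x != 0.
Proof.
move=> HE /(_ x)[v wv].
have /choice[s sP] : forall k, exists s : section E, smooth_section s /\ s x = v k.
  by move=> k; exact: section_through.
exists s; split=> [k|]; first by have [] := sP k.
rewrite /top_eval (_ : (fun k => s k x) = v)//.
by apply/funext => k; have [] := sP k.
Qed.

End Cocycles.

Section ModularClosed.
Context {R : realType} {m : nat} {M : charted R m} {n : nat} {B : vbundle M n}
  {L : algebroid B}.
Hypothesis HM : has_atlas M.
Hypothesis HB : is_vbundle B.
Hypothesis HL : is_lie_algebroid L.
Variables (eta : top_form (dual_bundle B)) (mu : top_form (tangent M))
  (xi : section (dual_bundle B)).
Hypothesis seta : smooth_top_form eta.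
Hypothesis smu : smooth_top_form mu.
Hypothesis xiP : is_modular_form L eta mu xi.

Let HD := dual_vbundle HM HB.
Let HT := tangent_vbundle HM.

Let P (X : section B) := lie_top (rho L X) (lie_covector L X) eta.
Let Q (X : section B) := lie_top (rho L X) (vbracket (rho L X)) mu.

Lemma modularE X al V x : smooth_section X -> (forall i, smooth_section (al i)) ->
  (forall j, smooth_section (V j)) ->
  xi x (X x) * (top_eval eta al x * top_eval mu V x) =
  P X al x * top_eval mu V x + top_eval eta al x * Q X V x.
Proof. by case: xiP => _ H sX sal sV; exact: H. Qed.

Let sP X al : smooth_section X -> (forall i, smooth_section (al i)) ->
  smooth_on setT (P X al).
Proof.
move=> sX sal; apply: (smooth_lie_top HM HD seta) => //; first exact: smooth_rho.
by move=> t; exact: smooth_lie_covector.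
Qed.

Let sQ X V : smooth_section X -> (forall j, smooth_section (V j)) ->
  smooth_on setT (Q X V).
Proof.
move=> sX sV; apply: (smooth_lie_top HM HT smu) => //; first exact: smooth_rho.
by move=> t; apply: (smooth_vbracket HM openT); exact: smooth_rho.
Qed.

(** [DP] and [DQ] are the iterated Lie derivatives [L_X (L_Y eta)] and [L_X (L_Y mu)], evaluated on
    [al] and [V]. *)
Let DP X Y al x := dirder x (rho L X x) (P Y al) -
  \sum_i P Y (upd al i (lie_covector L X (al i))) x.
Let DQ X Y V x := dirder x (rho L X x) (Q Y V) -
  \sum_j Q Y (upd V j (vbracket (rho L X) (V j))) x.

(* The identity defining <xi, Y>, differentiated along X.  The terms [P Y * Q X]
   and [P X * Q Y] are symmetric in [X] and [Y]. *)
Lemma modular_derived X Y al V x : smooth_section X -> smooth_section Y ->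
  (forall i, smooth_section (al i)) -> (forall j, smooth_section (V j)) ->
  (dirder x (rho L X x) (fun y => xi y (Y y)) + xi x (X x) * xi x (Y x)) *
    (top_eval eta al x * top_eval mu V x) =
  DP X Y al x * top_eval mu V x + P Y al x * Q X V x + P X al x * Q Y V x +
  top_eval eta al x * DQ X Y V x.
Proof.
move=> sX sY sal sV.
pose al' i := upd al i (lie_covector L X (al i)).
pose V' j := upd V j (vbracket (rho L X) (V j)).
have sal' i : forall k, smooth_section (al' i k).
  by apply: smooth_upd => //; exact: smooth_lie_covector.
have sV' j : forall k, smooth_section (V' j k).
  by apply: smooth_upd => //; exact: (smooth_vbracket HM openT (smooth_rho HL sX) (sV j)).
have sh := smooth_eval HM HD seta sal; have sk := smooth_eval HM HT smu sV.
have Ux : setT x := I; set v := rho L X x.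
have sxi : smooth_section xi by case: xiP.
have sxY : smooth_on setT (fun y => xi y (Y y)).
  exact: (smooth_pairing HM HB openT sY sxi).
have shk := smooth_mul HM openT sh sk.
(* The defining identity for [Y], taken as an equality of functions and differentiated along
   [rho L X]. *)
have E1 : dirder x v (fun y => xi y (Y y)) * (top_eval eta al x * top_eval mu V x)
    + xi x (Y x) * (top_eval eta al x * dirder x v (top_eval mu V) +
                    top_eval mu V x * dirder x v (top_eval eta al)) =
    P Y al x * dirder x v (top_eval mu V) + top_eval mu V x * dirder x v (P Y al) +
    (top_eval eta al x * dirder x v (Q Y V) + Q Y V x * dirder x v (top_eval eta al)).
  rewrite -(dirderM HM Ux _ sh sk) -(dirderM HM Ux _ (sP sY sal) sk).
  rewrite -(dirderM HM Ux _ sh (sQ sY sV)).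
  rewrite mulrC addrC -(dirderM HM Ux _ sxY shk).
  have s1 := smooth_mul HM openT (sP sY sal) sk.
  have s2 := smooth_mul HM openT sh (sQ sY sV).
  rewrite -(dirderD HM Ux _ s1 s2); congr (dirder x v _); apply/funext => y.
  exact: modularE.
(* [E2] and [E3] are the defining identity for [Y] with one argument replaced by its Lie derivative
   along [X], summed over the slots. Subtracting them from [E1] turns derivatives of values into Lie
   derivatives of the forms. *)
have E2 : xi x (Y x) * ((\sum_i top_eval eta (al' i) x) * top_eval mu V x) =
    (\sum_i P Y (al' i) x) * top_eval mu V x + (\sum_i top_eval eta (al' i) x) * Q Y V x.
  rewrite !mulr_suml mulr_sumr -big_split; apply: eq_bigr => i _.
  exact: (modularE x sY (sal' i) sV).
have E3 : xi x (Y x) * (top_eval eta al x * (\sum_j top_eval mu (V' j) x)) =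
    P Y al x * (\sum_j top_eval mu (V' j) x) + top_eval eta al x * (\sum_j Q Y (V' j) x).
  rewrite !mulr_sumr -big_split; apply: eq_bigr => j _.
  exact: (modularE x sY sal (sV' j)).
have E4 := modularE x sX sal sV.
have PE : P X al x = dirder x v (top_eval eta al) - \sum_i top_eval eta (al' i) x.
  exact: lie_topE.
have QE : Q X V x = dirder x v (top_eval mu V) - \sum_j top_eval mu (V' j) x.
  exact: lie_topE.
rewrite /DP /DQ -/v -/(al' _) -/(V' _).
rewrite mulrDl [xi x (X x) * _]mulrC -mulrA E4.
move: PE QE E1 E2 E3; rewrite /al' /V'.
move: (\sum_i P _ _ _) (\sum_i top_eval eta _ _) (\sum_j Q _ _ _) (\sum_j top_eval mu _ _).
move: (P X al x) (Q X V x) (P Y al x) (Q Y V x) (xi x (Y x)) (top_eval eta al x)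
  (top_eval mu V x) (dirder x v (top_eval mu V)) (dirder x v (top_eval eta al))
  (dirder x v (P Y al)) (dirder x v (Q Y V)) (dirder x v (fun y => xi y (Y y))).
clear=> p q p' q' c h k Xk Xh Xp Xq Xc sp sh sq sk -> -> E1 E2 E3.
transitivity (Xc * (h * k) + c * (h * Xk + k * Xh) - c * (sh * k) - c * (h * sk)).
  ring.
rewrite E1 E2 E3; ring.
Qed.

Lemma modular_closed : nonvanishing eta -> nonvanishing mu -> cocycle1 L xi.
Proof.
move=> eta0 mu0; split; first by case: xiP.
move=> X Y sX sY x.
have [al [sal h0]] := test_sections HM x HD eta0.
have [V [sV k0]] := test_sections HM x HT mu0.
have sXY := smooth_bracket HL sX sY.
(* On both determinant factors the commutator of Lie derivatives is the Lie derivative along the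
   bracket. The right-hand side below thus becomes the defining identity for [bracket L X Y]. *)
have EP : DP X Y al x - DP Y X al x = P (bracket L X Y) al x.
  rewrite /DP /P rho_bracket//.
  apply: (lie_top_commutator HM HD seta (smooth_rho HL sX) (smooth_rho HL sY)) => //.
  - by move=> t; exact: smooth_lie_covector.
  - by move=> t; exact: smooth_lie_covector.
  - by move=> t st; exact: lie_covector_bracket.
have EQ : DQ X Y V x - DQ Y X V x = Q (bracket L X Y) V x.
  rewrite /DQ /Q rho_bracket//.
  apply: (lie_top_commutator HM HT smu (smooth_rho HL sX) (smooth_rho HL sY)) => //.
  - by move=> t; apply: (smooth_vbracket HM openT); exact: smooth_rho.
  - by move=> t; apply: (smooth_vbracket HM openT); exact: smooth_rho.
  - by move=> t st; apply: vbracket_jacobi => //; exact: smooth_rho.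
have E1 := modular_derived x sX sY sal sV.
have E2 := modular_derived x sY sX sal sV.
have E3 := modularE x sXY sal sV.
apply: (mulIf (mulf_neq0 h0 k0)); rewrite mul0r.
move: EP EQ E1 E2 E3.
move: (P (bracket L X Y) al x) (Q (bracket L X Y) V x) (P X al x) (Q X V x)
  (P Y al x) (Q Y V x) (DP X Y al x) (DP Y X al x)
  (DQ X Y V x) (DQ Y X V x) (xi x (X x)) (xi x (Y x)) (xi x (bracket L X Y x)).
move: (dirder x (rho L X x) (fun y => xi y (Y y)))
  (dirder x (rho L Y x) (fun y => xi y (X y))) (top_eval eta al x) (top_eval mu V x).
clear=> d1 d2 h k p q p1 q1 p2 q2 D1 D2 Q1 Q2 c1 c2 c3 EP EQ E1 E2 E3.
transitivity ((d1 + c1 * c2) * (h * k) - (d2 + c2 * c1) * (h * k) - c3 * (h * k)).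
  ring.
rewrite E1 E2 E3 -EP -EQ; ring.
Qed.

End ModularClosed.

(** * The cylinder *)

Lemma fst_continuous (T U : topologicalType) : continuous (@fst T U).
Proof. by move=> p; exact: cvg_fst. Qed.

Lemma snd_continuous (T U : topologicalType) : continuous (@snd T U).
Proof. by move=> p; exact: cvg_snd. Qed.

Lemma setXT_preimage (T U : Type) (A : set T) : A `*` [set: U] = fst @^-1` A.
Proof. by apply/seteqP; split=> -[p t] // []. Qed.

Lemma open_setXT (T U : topologicalType) (A : set T) : open A -> open (A `*` [set: U]).
Proof.
move=> oA; rewrite setXT_preimage; apply: open_comp => // p _.
exact: fst_continuous.
Qed.

Lemma hausdorff_prod (T U : topologicalType) :
  hausdorff_space T -> hausdorff_space U -> hausdorff_space (T * U)%type.
Proof.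
move=> hT hU p q pq.
have e1 : p.1 = q.1.
  apply: hT => A B pA qB.
  have [r [rA rB]] := pq _ _ (fst_continuous pA) (fst_continuous qB).
  by exists r.1.
have e2 : p.2 = q.2.
  apply: hU => A B pA qB.
  have [r [rA rB]] := pq _ _ (snd_continuous pA) (snd_continuous qB).
  by exists r.2.
by case: p q e1 e2 {pq} => [? ?] [? ?] /= -> ->.
Qed.

Lemma eq_continuous_at (T U : topologicalType) (f g : T -> U) x : f =1 g ->
  {for x, continuous f} -> {for x, continuous g}.
Proof. by move=> /funext ->. Qed.

Lemma continuous_row (R : realType) m (T : topologicalType) (G : T -> 'rV[R]_m) x :
  (forall j, {for x, continuous (fun y => G y 0 j)}) -> {for x, continuous G}.
Proof.
move=> cG; apply: (proj2 (@cvgrPdist_lt _ _ _ _ _ _ _)) => e e0.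
have H : \forall y \near x, forall j, `|G x 0 j - G y 0 j| < e.
  apply: filter_forall => j.
  exact: (proj1 (@cvgrPdist_lt _ _ _ _ _ _ _) (cG j) e e0).
apply: filterS H => y yH.
rewrite /Num.Def.normr /= mx_normrE; apply/bigmax_ltP; split=> // -[i j] _ /=.
by rewrite !mxE ord1.
Qed.

#[local] Transparent dirder.

Section Cylinder.
Context {R : realType} {m : nat} {M : charted R m}.
Hypothesis HM : has_atlas M.
Local Notation N := (cylinder M).
Implicit Types (p q : N) (x : M).

Lemma lsubmx_continuous : continuous (@lsubmx R 1 m 1).
Proof.
move=> a; apply: continuous_row => j.
apply: (@eq_continuous_at _ _ (fun b : 'rV[R]_(m + 1) => b 0 (lshift 1 j))).
  by move=> b; rewrite mxE.
exact: coord_continuous.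
Qed.

Lemma cylinder_img p (U : set M) : cmap p @` ((U `*` setT) `&` cdom p) =
  @lsubmx R 1 m 1 @^-1` (cmap p.1 @` (U `&` cdom p.1)).
Proof.
apply/seteqP; split=> [_ [q [[Uq _] [xq _]] <-]|a [y [Uy xy] ya]] /=.
  by exists q.1 => //; rewrite row_mxKl.
exists (y, rsubmx a 0 0) => //=; rewrite ya -[RHS]hsubmxK; congr row_mx.
by apply/matrixP => i j; rewrite !ord1 !mxE eqxx.
Qed.

Lemma cylinder_img' p : cmap p @` cdom p =
  @lsubmx R 1 m 1 @^-1` (cmap p.1 @` cdom p.1).
Proof.
have := cylinder_img p setT; rewrite setXTT !setTI //.
Qed.

Lemma open_lsubmx (A : set 'rV[R]_m) : open A -> open (@lsubmx R 1 m 1 @^-1` A).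
Proof. by move=> oA; apply: open_comp => // a _; exact: lsubmx_continuous. Qed.

Lemma Ck_lsubmx k (D : set 'rV[R]_m) f : open D -> Ck k.+1 D f ->
  Ck k (@lsubmx R 1 m 1 @^-1` D) (f \o lsubmx).
Proof.
move=> oD fk; apply: (Ck_comp (open_lsubmx oD) _ fk) => // j.
by under eq_fun do rewrite mxE; exact: Ck_coord.
Qed.

Lemma cylinder_atlas : has_atlas N.
Proof.
split.
- by apply: hausdorff_prod; [case: HM|exact: Rhausdorff].
- move=> p; split; [exact/open_setXT/cdom_open|by split=> //; exact: cdomxx|].
  by rewrite cylinder_img'; apply: open_lsubmx; exact: cimg_open.
- move=> p; split.
  + move=> q /set_mem[xq _]; case: q xq => [y t] /= xy.
    by rewrite row_mxKl row_mxKr mxE eqxx (cmapK HM).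
  + apply: continuous_in_subspaceT => q /set_mem[xq _].
    apply: continuous_row => j; case: (split_ordP j) => i ->.
      apply: (@eq_continuous_at _ _ ((fun y => cmap p.1 y 0 i) \o @fst M R)).
        by move=> r; rewrite /= row_mxEl.
      apply: (@continuous_comp _ _ _ (@fst M R) (fun y => cmap p.1 y 0 i)).
        exact: fst_continuous.
      exact: (smooth_continuous HM xq (@smooth_coord _ _ _ HM p.1 i)).
    apply: (@eq_continuous_at _ _ (@snd M R)); last exact: snd_continuous.
    by move=> r; rewrite /= row_mxEr ord1 mxE eqxx mulr1n.
  + apply: continuous_in_subspaceT => a /set_mem; rewrite cylinder_img' => xa.
    have c1 : {for a, continuous (cinv p.1 \o @lsubmx R 1 m 1)}.
      apply: (@continuous_comp _ _ _ (@lsubmx R 1 m 1) (cinv p.1)).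
        exact: lsubmx_continuous.
      exact: cinv_continuous.
    have c2 : {for a, continuous (fun b : 'rV[R]_(m + 1) => rsubmx b 0 0)}.
      apply: (@eq_continuous_at _ _ (fun b : 'rV[R]_(m + 1) => b 0 (rshift m 0))).
        by move=> b; rewrite mxE.
      exact: coord_continuous.
    exact: (cvg_pair c1 c2).
- move=> p q j k.
  (* The overlap is put in the product form to which [cylinder_img] applies: both chart domains
     contain the whole time axis. *)
  have -> : cdom p `&` cdom q = ((cdom q.1 `*` setT) `&` cdom p) :> set N.
    by apply/seteqP; split=> -[y t] [[? ?] [? ?]]; split.
  rewrite cylinder_img.
  case: (split_ordP j) => i ->.
    under eq_fun do rewrite row_mxEl.
    apply: (@Ck_lsubmx k _ (fun b => cmap q.1 (cinv p.1 b) 0 i)).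
      exact/chart_open/cdom_open.
    by rewrite setIC; case: HM => _ _ _; exact.
  have -> : (fun a : 'rV[R]_(m + 1) => cmap q (cinv p a) 0 (rshift m i)) =
      (fun a => a 0 (rshift m 0)); last exact: Ck_coord.
  by apply/funext => a; rewrite /= row_mxEr ord1 mxE eqxx mulr1n mxE.
Qed.

Lemma smooth_fst (U : set M) (f : M -> R) : open U -> smooth_on U f ->
  smooth_on (U `*` setT : set N) (fun p => f p.1).
Proof.
move=> oU sf p k; rewrite cylinder_img.
exact: (Ck_lsubmx (@chart_open _ _ _ HM p.1 _ oU) (sf p.1 k.+1)).
Qed.

Lemma smooth_fstT (f : M -> R) : smooth_on setT f ->
  smooth_on (setT : set N) (fun p => f p.1).
Proof. by move=> sf; rewrite -setXTT; apply: smooth_fst; [exact: openT|]. Qed.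

Lemma snd_cinv p : (snd \o cinv p : 'rV[R]_(m + 1) -> R) = (fun a => a 0 (rshift m 0)).
Proof. by apply/funext => a; rewrite /= mxE. Qed.

Lemma smooth_snd : smooth_on (setT : set N) snd.
Proof. by move=> p k; rewrite snd_cinv; exact: Ck_coord. Qed.

Lemma derive_lsubmx (F : 'rV[R]_m -> R) (a u : 'rV[R]_(m + 1)) :
  'D_u (fun b => F (lsubmx b)) a = 'D_(lsubmx u) F (lsubmx a).
Proof.
rewrite /derive; set d := (fun _ : R => _); set d' := (fun _ : R => _).
suff -> : d = d' by [].
apply/funext => h; rewrite /d /d' /=; congr (_ *: (F _ - _)).
by apply/rowP => j; rewrite !mxE.
Qed.

Lemma dirder_fst p (u : 'rV[R]_(m + 1)) (f : M -> R) :
  dirder p u (fun q : N => f q.1) = dirder p.1 (lsubmx u) f.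
Proof.
rewrite /dirder -[RHS]/('D_(lsubmx u) (f \o cinv p.1) (cmap p.1 p.1)).
have e : lsubmx (cmap p p) = cmap p.1 p.1 by rewrite row_mxKl.
by rewrite -[in RHS]e -derive_lsubmx.
Qed.

Lemma dirder_snd p (u : 'rV[R]_(m + 1)) : dirder p u (snd : N -> R) = rsubmx u 0 0.
Proof.
rewrite /dirder (snd_cinv p) [RHS]mxE; exact: (derive_coord (rshift m 0) u (cmap p p)).
Qed.

(* The vector field [V + g d/dt] for a vector field [V] and a function [g] on [M]. *)
Definition lift_field (V : section (tangent M)) (g : M -> R) : section (tangent N) :=
  fun p => row_mx (V p.1) (g p.1)%:M.

Lemma dirder_lift_fst V g p f :
  dirder p (lift_field V g p) (fun q : N => f q.1) = dirder p.1 (V p.1) f.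
Proof. by rewrite dirder_fst row_mxKl. Qed.

Lemma dirder_lift_snd V g p : dirder p (lift_field V g p) (snd : N -> R) = g p.1.
Proof. by rewrite dirder_snd row_mxKr mxE eqxx. Qed.

Lemma dirder_lift_lshift V g p q i :
  dirder q (lift_field V g q) (fun r : N => cmap p r 0 (lshift 1 i)) =
  dirder q.1 (V q.1) (fun y => cmap p.1 y 0 i).
Proof.
rewrite -(dirder_lift_fst V g); congr dirder.
by apply/funext => r /=; rewrite row_mxEl.
Qed.

Lemma dirder_lift_rshift V g p q i :
  dirder q (lift_field V g q) (fun r : N => cmap p r 0 (rshift m i)) = g q.1.
Proof.
rewrite -(dirder_lift_snd V g); congr dirder.
by apply/funext => r /=; rewrite row_mxEr ord1 mxE eqxx.
Qed.

Lemma smooth_lift_field (U : set M) V g : open U -> smooth_section_on U V ->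
  smooth_on U g -> smooth_section_on (U `*` setT : set N) (lift_field V g).
Proof.
move=> oU /(smooth_vectorP HM _ oU) sV sg.
apply/(smooth_vectorP cylinder_atlas _ (open_setXT oU)) => p j.
case: (split_ordP j) => i ->.
  under eq_fun do rewrite dirder_lift_lshift.
  have -> : (U `*` setT) `&` cdom p = (U `&` cdom p.1) `*` setT :> set N.
    apply/seteqP; split=> -[y t] /=; first by move=> [[Uy _] [xy _]].
    by move=> [[Uy xy] _]; split; split.
  apply: (@smooth_fst _ (fun x => dirder x (V x) (fun y => cmap p.1 y 0 i))) => //.
  by apply: openI => //; exact: cdom_open.
under eq_fun do rewrite dirder_lift_rshift.
by apply: smooth_sub (smooth_fst oU sg) => q [].
Qed.

#[local] Opaque dirder.

(** The anchor of a time-independent section, the lifts of fields on [M] and d/dt are all of this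
    form, with last component [<phi0, X>], 0 and 1. All brackets in the Lie derivative of [muH] are
    computed from this formula. *)
Lemma vbracket_lift V g W h : vbracket (lift_field V g) (lift_field W h) =
  lift_field (vbracket V W) (fun x => dirder x (V x) h - dirder x (W x) g).
Proof.
have El V1 g1 V2 g2 p i : dirder p (lift_field V1 g1 p)
    (fun q => dirder q (lift_field V2 g2 q) (fun r : N => cmap p r 0 (lshift 1 i))) =
    dirder p.1 (V1 p.1) (fun x => dirder x (V2 x) (fun y => cmap p.1 y 0 i)).
  under eq_fun do rewrite dirder_lift_lshift.
  exact: (dirder_lift_fst V1 g1 p (fun x => dirder x (V2 x) (fun y => cmap p.1 y 0 i))).
have Er V1 g1 V2 g2 p i : dirder p (lift_field V1 g1 p)
    (fun q => dirder q (lift_field V2 g2 q) (fun r : N => cmap p r 0 (rshift m i))) =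
    dirder p.1 (V1 p.1) g2.
  under eq_fun do rewrite dirder_lift_rshift.
  exact: (dirder_lift_fst V1 g1 p g2).
apply: eq_section => p; apply/rowP => j; rewrite mxE.
case: (split_ordP j) => i ->.
  by rewrite !El row_mxEl mxE.
by rewrite !Er row_mxEr !ord1 mxE eqxx mulr1n.
Qed.

End Cylinder.

#[local] Opaque dirder.

Lemma split_lshift k l (i : 'I_k) : fintype.split (lshift l i) = inl i.
Proof. exact: (unsplitK (inl i)). Qed.

Lemma split_rshift k l (i : 'I_l) : fintype.split (rshift k i) = inr i.
Proof. exact: (unsplitK (inr i)). Qed.

(** * The bundle over the cylinder and its induced algebroid *)

Section Hat.
Context {R : realType} {m : nat} {M : charted R m} {n : nat} {A : vbundle M n}.
Hypothesis HM : has_atlas M.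
Hypothesis HA : is_vbundle A.
Local Notation N := (cylinder M).
Implicit Types (X Y : section A) (p : N).

Let HN : has_atlas N := cylinder_atlas HM.

Let fdomX (i : fidx A) : (setT `&` fdom i) `*` [set: R] =
  setT `&` (fdom (v := hat A) i) :> set N.
Proof. by rewrite !setTI. Qed.

Lemma hat_vbundle : is_vbundle (hat A).
Proof.
split=> [i|p|i p [ix _]|i k j].
- exact/open_setXT/(fdom_open HA).
- by have [i ix] := fdom_cover HA p.1; exists i.
- exact: (frame_basis HA ix).
- have [c [sc cE]] := smooth_frame HA i k j.
  have oij : open (fdom (v := A) i `&` fdom (v := A) j) by apply: openI; exact: (fdom_open HA).
  exists (fun l p => c l p.1); split=> [l|p [[ix _] [jx _]]]; last exact: cE.
  apply: smooth_sub (smooth_fst HM oij (sc l)) => p [[ix _] [jx _]].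
  by split; split.
Qed.

Lemma smooth_time_indep X : smooth_section X -> smooth_section (time_indep X).
Proof.
move=> sX i; have [c [sc cE]] := sX i.
have oi : open (setT `&` fdom (v := A) i) by rewrite setTI; exact: (fdom_open HA).
exists (fun k p => c k p.1); split=> [k|p [_ [ix _]]]; last by apply: cE.
by rewrite -fdomX; exact: (smooth_fst HM oi (sc k)).
Qed.

Lemma smooth_time_indep_dual (al : section (dual_bundle A)) : smooth_section al ->
  smooth_section (time_indep_dual al).
Proof.
move=> sal i; have [c [sc cE]] := sal i.
have oi : open (setT `&` fdom (v := A) i) by rewrite setTI; exact: (fdom_open HA).
exists (fun k p => c k p.1); split=> [k|p [_ [ix _]]]; last by apply: cE.
by rewrite -fdomX; exact: (smooth_fst HM oi (sc k)).
Qed.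

Context {L : algebroid A} {phi0 : section (dual_bundle A)} {Lhat : algebroid (hat A)}.
Hypothesis HL : is_lie_algebroid L.
Hypothesis Hind : is_induced_algebroid L phi0 Lhat.

Let HH : is_lie_algebroid Lhat. Proof. by case: Hind. Qed.

Lemma rho_hat X : smooth_section X ->
  rho Lhat (time_indep X) = lift_field (rho L X) (fun x => phi0 x (X x)).
Proof. by case: Hind => _ _ + sX => ->. Qed.

Lemma bracket_hat X Y : smooth_section X -> smooth_section Y ->
  bracket Lhat (time_indep X) (time_indep Y) = time_indep (bracket L X Y).
Proof. by case: Hind => _ + _ sX sY => ->. Qed.

(** Tested on time-independent sections: the d/dt part of the anchor kills pairings pulled back from
    [M], and the brackets agree. *)
Lemma lie_covector_hat X (al : section (dual_bundle A)) p :
  smooth_section X -> smooth_section al ->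
  lie_covector Lhat (time_indep X) (time_indep_dual al) p =
  lie_covector L X al p.1 :> 'Hom(A p.1, R^o).
Proof.
move=> sX sal; apply/lfunP => v; have [Z [sZ <-]] := section_through HM HA v.
apply: (etrans (lie_covectorE HN hat_vbundle HH p (smooth_time_indep sX)
  (smooth_time_indep_dual sal) (smooth_time_indep sZ))).
rewrite [RHS]lie_covectorE//.
rewrite bracket_hat// rho_hat//; congr (_ - _).
exact: (dirder_lift_fst (rho L X) (fun x => phi0 x (X x)) p (fun x => al x (Z x))).
Qed.

(* The frame [v_1, .., v_m, d/dt] of a tangent space of the cylinder. *)
Definition ext_frame (v : 'I_m -> 'rV[R]_m) : 'I_(m + 1) -> 'rV[R]_(m + 1) :=
  fun j => match fintype.split j with inl i => row_mx (v i) 0 | inr _ => row_mx 0 1%:M end.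

(** Even d/dt is written as a [lift_field], so that [vbracket_lift] covers every slot. *)
Definition ext_fields (V : 'I_m -> section (tangent M)) :
    'I_(m + 1) -> section (tangent N) :=
  fun j => match fintype.split j with
    | inl i => lift_field (V i) (fun=> 0)
    | inr _ => lift_field (fun x => 0 : tangent M x) (fun=> 1)
  end.

Lemma ext_fieldsE V p : (fun j => ext_fields V j p) = ext_frame (fun i => V i p.1).
Proof.
apply/funext => j; rewrite /ext_fields /ext_frame; case: (fintype.split j) => // i.
by rewrite /lift_field raddf0.
Qed.

Lemma smooth_ext_fields (U : set M) V : open U -> (forall i, smooth_section_on U (V i)) ->
  forall j, smooth_section_on (U `*` setT : set N) (ext_fields V j).
Proof.
move=> oU sV j; rewrite /ext_fields; case: (fintype.split j) => i; apply: smooth_lift_field => //.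
- exact: smooth_cst.
- exact: (smooth_section0 HM (tangent_vbundle HM) oU).
- exact: smooth_cst.
Qed.

(** The form obtained is the contraction of [w] with d/dt in the last slot, restricted to vectors
    tangent to [M]. *)
Lemma ext_frame_alternating (w : ('I_(m + 1) -> 'rV[R]_(m + 1)) -> R) :
  Defs.alternating w -> Defs.alternating (fun v => w (ext_frame v)).
Proof.
move=> [wL w0].
have extE v i u : ext_frame [eta v with i |-> u] =
    [eta ext_frame v with lshift 1 i |-> row_mx u 0].
  apply/funext => j; rewrite /ext_frame /=; case: (split_ordP j) => k ->.
    by rewrite eq_lshift; case: ifP.
  by rewrite eq_rlshift.
split=> [v i a u u'|v i j ij vij].
  rewrite !extE -wL; congr (w [eta _ with _ |-> _]).
  by rewrite scale_row_mx add_row_mx scaler0 addr0.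
apply: (w0 _ (lshift 1 i) (lshift 1 j)); first by rewrite eq_lshift.
by rewrite /ext_frame !split_lshift vij.
Qed.

Lemma ext_frame_delta : ext_frame (fun i => delta_mx 0 i) = fun j => delta_mx 0 j.
Proof.
apply/funext => j; rewrite /ext_frame; case: (split_ordP j) => k ->.
  apply/rowP => l; rewrite !mxE eqxx /=.
  by case: (split_ordP l) => l' -> ; rewrite ?eq_lshift ?eq_rlshift mxE ?eqxx.
apply/rowP => l; rewrite !mxE eqxx /=.
by case: (split_ordP l) => l' ->; rewrite ?eq_rshift ?eq_lrshift mxE ?ord1.
Qed.

End Hat.

(** The fibre of top forms is a line, which gives the ratio pointwise. Over each frame it is a
    quotient of smooth coefficients, hence smooth. *)
Lemma top_form_ratio_fun (R : realType) m (M : charted R m) n (E : vbundle M n)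
    (w w' : top_form E) : has_atlas M -> is_vbundle E ->
  smooth_top_form w -> nonvanishing w -> smooth_top_form w' -> nonvanishing w' ->
  exists g : M -> R, [/\ smooth_on setT g, forall x, g x != 0 &
    forall x v, w' x v = g x * w x v].
Proof.
move=> HM HE sw w0 sw' w'0.
have /choice[g gP] : forall x, exists c, forall v, w' x v = c * w x v.
  move=> x; have [i ix] := fdom_cover HE x.
  exists (w' x (fun k => frame i k x) / w x (fun k => frame i k x)) => v.
  exact: top_form_ratio.
exists g; split=> // [|x]; last first.
  have [v] := w'0 x; apply: contra_neq => gx; by rewrite gP gx mul0r.
apply: smooth_local => x _; have [i ix] := fdom_cover HE x; exists (fdom i) => //.
have oi := fdom_open HE i; have wi y := nonvanishing_frame HE sw w0 (i := i) (x := y).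
apply: (smooth_eq HM (f := fun y => w' y (fun k => frame i k y) *
   (w y (fun k => frame i k y))^-1)) => //.
  by move=> y /set_mem iy; rewrite gP mulfK//; exact: wi.
by apply: smooth_mul => //; [exact: sw'.2|apply: smooth_inv => //; exact: sw.2].
Qed.

Lemma dirder0v (R : realType) m (M : charted R m) (x : M) f : dirder x 0 f = 0.
Proof. exact: derive0. Qed.

(** * Comparison of the modular forms on time-independent sections *)

Section Compare.
Context {R : realType} {m : nat} {M : charted R m} {n : nat} {A : vbundle M n}.
Hypothesis HM : has_atlas M.
Hypothesis HA : is_vbundle A.
Local Notation N := (cylinder M).
Implicit Types (X Y : section A) (p : N).

Let HN : has_atlas N := cylinder_atlas HM.
Let HT := tangent_vbundle HM.
Let HTN := tangent_vbundle HN.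

(** The form [mu /\ dt] is never constructed: [muH] is compared with [mu] through its contraction
    with d/dt. *)
Lemma tangent_form_ratio (mu : top_form (tangent M)) (muH : top_form (tangent N)) :
  smooth_top_form mu -> nonvanishing mu -> smooth_top_form muH -> nonvanishing muH ->
  exists k : N -> R, [/\ smooth_on setT k, forall p, k p != 0 &
    forall p (v : 'I_m -> 'rV[R]_m), muH p (ext_frame v) = k p * mu p.1 v].
Proof.
move=> smu mu0 smuH muH0.
have muf p := nonvanishing_frame HT smu mu0 (cdomxx HM p.1).
have /choice[k kP] : forall p, exists c, forall v : 'I_m -> 'rV[R]_m,
    muH p (ext_frame v) = c * mu p.1 v.
  move=> p; have B := frame_basis HT (cdomxx HM p.1).
  have wA := ext_frame_alternating (smuH.1 p).
  have e : tnth [tuple frame (v := tangent M) p.1 k p.1 | k < m] =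
      fun k => frame (v := tangent M) p.1 k p.1.
    by apply/funext => k; rewrite tnth_mktuple.
  have mp : mu p.1 (tnth [tuple frame (v := tangent M) p.1 k p.1 | k < m]) != 0.
    by rewrite e.
  exists (muH p (ext_frame (tnth [tuple frame (v := tangent M) p.1 k p.1 | k < m])) /
    mu p.1 (tnth [tuple frame (v := tangent M) p.1 k p.1 | k < m])) => v.
  exact: (alternating_ratio B v (smu.1 p.1) wA mp).
exists k; split=> // [|p]; last first.
  (* If [k p] were 0, [muH] would vanish at [p] on the standard basis, which is an extended frame,
     and so on all vectors. *)
  have [v] := muH0 p; apply: contra_neq => kp.
  have := alternating_det (fun j => delta_mx 0 j : 'rV[R]_(m + 1))
    (\matrix_(i, j) v i 0 j) (smuH.1 p).
  have -> : muH p (fun j => delta_mx 0 j) = 0 by rewrite -ext_frame_delta kP kp mul0r.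
  rewrite mulr0 => <-.
  apply: eq_alternating => i; rewrite [LHS]row_sum_delta.
  by apply: eq_bigr => j _; rewrite mxE.
apply: smooth_local => p _; pose U := cdom p.1.
have oU : open U by exact: cdom_open.
have oUT : open (U `*` setT : set N) by exact: open_setXT.
exists (U `*` setT : set N); first by split=> //; exact: cdomxx.
(* On the coordinate fields [F] both forms have smooth values and [mu] has no zero, so [k] is
   locally their quotient. *)
pose F : 'I_m -> section (tangent M) := fun i => coordv p.1 i.
have sF i : smooth_section_on U (F i) by exact: (smooth_frame HT).
apply: (smooth_eq HN (f := fun q : N => muH q (fun j => ext_fields F j q) *
   (mu q.1 (fun i => F i q.1))^-1)) => //.
  move=> q /set_mem[Uq _]; rewrite ext_fieldsE kP mulfK//.
  exact: (nonvanishing_frame HT smu mu0 (i := p.1)).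
apply: (smooth_mul HN oUT).
  exact: (smooth_top_eval HN HTN oUT smuH (smooth_ext_fields HM oU sF)).
apply: (smooth_inv HN oUT) => [q [Uq _]|].
  exact: (nonvanishing_frame HT smu mu0 (i := p.1)).
exact: (smooth_fst HM oU (smu.2 p.1)).
Qed.

Context {L : algebroid A} {phi0 : section (dual_bundle A)} {Lhat : algebroid (hat A)}.
Hypothesis HL : is_lie_algebroid L.
Hypothesis Hind : is_induced_algebroid L phi0 Lhat.

Let HH : is_lie_algebroid Lhat. Proof. by case: Hind. Qed.
Let HhA := hat_vbundle HM HA.
Let HDH := dual_vbundle HN HhA.

Lemma dirder_hat_fst X p (f : M -> R) : smooth_section X ->
  dirder p (rho Lhat (time_indep X) p) (fun q : N => f q.1) =
  dirder p.1 (rho L X p.1) f.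
Proof.
move=> sX; rewrite (rho_hat Hind sX).
exact: (dirder_lift_fst (rho L X) (fun x => phi0 x (X x)) p f).
Qed.

Lemma dirder_hat_snd X p : smooth_section X ->
  dirder p (rho Lhat (time_indep X) p) (snd : N -> R) = phi0 p.1 (X p.1).
Proof.
move=> sX; rewrite (rho_hat Hind sX).
exact: (dirder_lift_snd (rho L X) (fun x => phi0 x (X x)) p).
Qed.

(** Leibniz rule for [g] times the pull-back of [eta]. *)
Lemma lie_top_hat_eta (etaH : top_form (dual_bundle (hat A)))
    (eta : top_form (dual_bundle A)) (g : N -> R) X al p :
  smooth_top_form eta -> smooth_on setT g ->
  (forall p v, etaH p v = g p * eta p.1 v) ->
  smooth_section X -> (forall i, smooth_section (al i)) ->
  lie_top (rho Lhat (time_indep X)) (lie_covector Lhat (time_indep X)) etaH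
    (fun i => time_indep_dual (al i)) p =
  dirder p (rho Lhat (time_indep X) p) g * top_eval eta al p.1 +
  g p * lie_top (rho L X) (lie_covector L X) eta al p.1.
Proof.
move=> seta sg etaE sX sal; rewrite !lie_topE.
have sh := smooth_eval HM (dual_vbundle HM HA) seta sal.
have -> : top_eval etaH (fun i => time_indep_dual (al i)) =
    fun q => g q * top_eval eta al q.1.
  by apply/funext => q; exact: etaE.
rewrite (dirderM HN (I : setT p) _ sg (smooth_fstT HM sh)) (dirder_hat_fst p _ sX).
have -> : \sum_i top_eval etaH (upd (fun i => time_indep_dual (al i)) i
      (lie_covector Lhat (time_indep X) (time_indep_dual (al i)))) p =
    g p * \sum_i top_eval eta (upd al i (lie_covector L X (al i))) p.1.
  rewrite mulr_sumr; apply: eq_bigr => i _; rewrite /top_eval etaE; congr (_ * _).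
  congr (eta p.1 _); apply/funext => k; rewrite /upd; case: ifP => // _.
  exact: (lie_covector_hat HM HA HL Hind p sX (sal i)).
by move: (dirder _ _ _) (dirder _ _ _) (\sum_i _) (top_eval _ _ _) (g p) => *; ring.
Qed.

Lemma lie_top_hat_mu (muH : top_form (tangent N)) (mu : top_form (tangent M))
    (k : N -> R) X V p :
  smooth_top_form mu -> smooth_top_form muH -> smooth_on setT k ->
  (forall p (v : 'I_m -> 'rV[R]_m), muH p (ext_frame v) = k p * mu p.1 v) ->
  smooth_section X -> (forall i, smooth_section (V i)) ->
  lie_top (rho Lhat (time_indep X)) (vbracket (rho Lhat (time_indep X))) muH
    (ext_fields V) p =
  dirder p (rho Lhat (time_indep X) p) k * top_eval mu V p.1 +
  k p * lie_top (rho L X) (vbracket (rho L X)) mu V p.1.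
Proof.
move=> smu smuH sk muE sX sV; rewrite !lie_topE.
have sh := smooth_eval HM HT smu sV.
have -> : top_eval muH (ext_fields V) = fun q => k q * top_eval mu V q.1.
  by apply/funext => q; rewrite /top_eval ext_fieldsE muE.
rewrite (dirderM HN (I : setT p) _ sk (smooth_fstT HM sh)) (dirder_hat_fst p _ sX).
have [wL w0] := smuH.1 p.
have -> : \sum_j top_eval muH (upd (ext_fields V) j
      (vbracket (rho Lhat (time_indep X)) (ext_fields V j))) p =
    k p * \sum_i top_eval mu (upd V i (vbracket (rho L X) (V i))) p.1.
  have updE j t : top_eval muH (upd (ext_fields V) j t) p =
      muH p [eta ext_frame (fun i => V i p.1) with j |-> t p].
    rewrite /top_eval -ext_fieldsE; congr (muH p _); apply/funext => l.
    by rewrite /upd /=; case: ifP.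
  have w00 v j : muH p [eta v with j |-> 0] = 0.
    have := wL v j (-1) 0 0; rewrite scaleN1r oppr0 addr0 => ->.
    by rewrite mulN1r addNr.
  (* The last slot holds d/dt, whose bracket with the anchor field vanishes because that field does
     not depend on time. *)
  rewrite big_split_ord /= [X in _ + X]big1 ?addr0 => [|i _]; last first.
    rewrite updE (rho_hat Hind sX) /ext_fields split_rshift vbracket_lift.
    rewrite (_ : lift_field _ _ p = 0) ?w00// /lift_field.
    rewrite dirder_cst (_ : vbracket _ _ p.1 = 0); last first.
      apply/rowP => l; rewrite !mxE dirder0v subr0.
      by under eq_fun do rewrite dirder0v; rewrite dirder_cst.
    by rewrite dirder0v subrr raddf0 row_mx0.
  rewrite mulr_sumr; apply: eq_bigr => i _; rewrite updE (rho_hat Hind sX).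
  rewrite /ext_fields split_lshift vbracket_lift /lift_field dirder_cst sub0r.
  set c := dirder _ _ _; set u := vbracket _ _ _.
  (* The bracket has the d/dt component [- c], where [c] is the derivative of [<phi0, X>] along
     [V i]. Since d/dt is already the last argument, this component is removed by alternation. *)
  have -> : row_mx u (- c)%:M = (- c) *: row_mx 0 1%:M + row_mx u 0.
    by rewrite scale_row_mx add_row_mx scaler0 add0r addr0 scale_scalar_mx mulr1.
  rewrite wL (w0 _ (lshift 1 i) (rshift m 0)) ?eq_lrshift//; last first.
    by rewrite /= eqxx eq_rlshift /ext_frame split_rshift.
  rewrite mulr0 add0r -muE; congr (muH p _); apply/funext => j.
  rewrite /ext_frame /=; case: (split_ordP j) => l ->.
    by rewrite eq_lshift /upd; case: ifP.
  by rewrite eq_rlshift.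
by move: (dirder _ _ _) (dirder _ _ _) (\sum_i _) (top_eval _ _ _) (k p) => *; ring.
Qed.

(** The forms on [M] are arbitrary here, so this applies both to the form underlying the Jacobi
    modular form and to [xi], each with its own [eta] and [mu]. *)
Lemma modular_form_hat (etaH : top_form (dual_bundle (hat A)))
    (muH : top_form (tangent N)) (xiH : section (dual_bundle (hat A)))
    (eta : top_form (dual_bundle A)) (mu : top_form (tangent M))
    (xi : section (dual_bundle A)) :
  smooth_top_form etaH -> nonvanishing etaH -> smooth_top_form muH -> nonvanishing muH ->
  is_modular_form Lhat etaH muH xiH ->
  smooth_top_form eta -> nonvanishing eta -> smooth_top_form mu -> nonvanishing mu ->
  is_modular_form L eta mu xi ->
  exists f : N -> R, smooth_on setT f /\
    forall p (v : hat A p), xiH p v - time_indep_dual xi p v = dirder p (anchor Lhat p v) f.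
Proof.
move=> setaH etaH0 smuH muH0 xiHP seta eta0 smu mu0 xiP.
pose etah : top_form (dual_bundle (hat A)) := fun p => eta p.1.
have setah : smooth_top_form etah.
  split=> [p|i]; first exact: seta.1.
  exact: (smooth_fst HM (fdom_open HA i) (seta.2 i)).
have etah0 : nonvanishing etah by move=> p; exact: eta0.
have [g [sg g0 gE]] := top_form_ratio_fun HN HDH setah etah0 setaH etaH0.
have [k [sk k0 kE]] := tangent_form_ratio smu mu0 smuH muH0.
have sgk := smooth_mul HN openT sg sk.
(* [ln |g k|], written as [ln ((g k) ^ 2) / 2] *)
pose u p := (g p * k p) * (g p * k p).
have su : smooth_on setT u := smooth_mul HN openT sgk sgk.
have u0 p : 0 < u p by rewrite /u -expr2 exprn_even_gt0//= mulf_neq0.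
have slu : smooth_on setT (fun p => ln (u p)) by exact: (smooth_ln HN openT).
exists (fun p => 2^-1 * ln (u p)); split.
  exact: (smooth_mul HN openT (smooth_cst _ _) slu).
move=> p v; have [X [sX <-]] := section_through HM HA v.
have [al [sal h0]] := test_sections HM p.1 (dual_vbundle HM HA) eta0.
have [V [sV h0']] := test_sections HM p.1 HT mu0.
have sVh j : smooth_section (ext_fields V j).
  by have := smooth_ext_fields HM openT sV j; rewrite setXTT.
have := modularE xiHP p (smooth_time_indep HM HA sX)
  (fun i => smooth_time_indep_dual HM HA (sal i)) sVh.
have := modularE xiP p.1 sX sal sV.
rewrite (lie_top_hat_eta p seta sg gE sX sal) (lie_top_hat_mu p smu smuH sk kE sX sV).
have -> : top_eval etaH (fun i => time_indep_dual (al i)) p = g p * top_eval eta al p.1.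
  exact: gE.
have -> : top_eval muH (ext_fields V) p = k p * top_eval mu V p.1.
  by rewrite /top_eval ext_fieldsE kE.
rewrite (dirderZ HN (I : setT p) _ _ slu) (dirder_ln HN (I : setT p) _ su (u0 p)).
rewrite (dirderM HN (I : setT p) _ sgk sgk) (dirderM HN (I : setT p) _ sg sk).
rewrite /time_indep_dual -[anchor Lhat p (X p.1)]/(rho Lhat (time_indep X) p).
rewrite -[xiH p (X p.1)]/(xiH p (time_indep X p)) /u.
move: (xiH p (time_indep X p)) (xi p.1 (X p.1)) => c c'.
move: (lie_top _ _ eta _ _) (lie_top _ _ mu _ _) (top_eval eta al p.1) h0
  (top_eval mu V p.1) h0' (g0 p) (k0 p).
move: (g p) (k p) (dirder p _ g) (dirder p _ k).
clear=> g k dg dk P Q h h0 h' h0' g0 k0 E1 E2.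
(* The difference of the modular forms times [g k] is the derivative of [g k]; the values [h] and
   [h'] of [eta] and [mu] cancel. *)
have E : (c - c') * (g * k) = dg * k + g * dk.
  apply: (mulIf (mulf_neq0 h0 h0')).
  transitivity (c * (g * h * (k * h')) - g * k * (c' * (h * h'))); first by ring.
  by rewrite E1 E2; ring.
have gk0 := mulf_neq0 g0 k0; apply: (mulIf gk0); rewrite E.
by field; rewrite k0 g0.
Qed.

End Compare.

(** Closedness passes from [al] to [be]; it is thus computed directly for the modular form of the
    cylinder alone. *)
Lemma cohomologous (R : realType) m (M : charted R m) n (B : vbundle M n)
    (L : algebroid B) (al be : section (dual_bundle B)) (f : M -> R) :
  has_atlas M -> is_vbundle B -> is_lie_algebroid L ->
  cocycle1 L al -> smooth_section be -> smooth_on setT f ->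
  (forall x (v : B x), al x v - be x v = dirder x (anchor L x v) f) ->
  same_H1_class L al be.
Proof.
move=> HM HB HL [sal cal] sbe sf ab; split=> //; last by exists f.
by split=> //; exact: (closed_of_exact_diff HM HB HL sal sbe sf ab cal).
Qed.

Unset Implicit Arguments.

Theorem proposition15 (R : realType) (m : nat) (M : charted R m)
  (n : nat) (A : vbundle M n) (L : algebroid A) (phi0 : section (dual_bundle A))
  (Lhat : algebroid (hat A))
  (etaH : top_form (dual_bundle (hat A))) (muH : top_form (tangent (cylinder M)))
  (xiH : section (dual_bundle (hat A)))
  (eta0 : top_form (dual_bundle A)) (mu0 : top_form (tangent M))
  (xi0 : section (dual_bundle A))
  (eta : top_form (dual_bundle A)) (mu : top_form (tangent M))
  (xi : section (dual_bundle A)) :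
  is_manifold M -> is_vbundle A -> is_jacobi_algebroid L phi0 ->
  orientable (tangent M) -> orientable A ->
  is_induced_algebroid L phi0 Lhat ->
  smooth_top_form etaH -> nonvanishing etaH ->
  smooth_top_form muH -> nonvanishing muH ->
  is_modular_form Lhat etaH muH xiH ->
  smooth_top_form eta0 -> nonvanishing eta0 ->
  smooth_top_form mu0 -> nonvanishing mu0 ->
  is_jacobi_modular_form L phi0 eta0 mu0 xi0 ->
  smooth_top_form eta -> nonvanishing eta ->
  smooth_top_form mu -> nonvanishing mu ->
  is_modular_form L eta mu xi ->
  same_H1_class Lhat xiH (time_indep_dual xi0) /\
  same_H1_class Lhat (time_indep_dual xi0) (time_indep_dual xi).
Proof.
move=> /manifold_has_atlas HM HA [HL [sphi0 _]] _ _ Hind setaH etaH0 smuH muH0 xiHP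
  seta0 eta00 smu0 mu00 [xi' [xi'P ->]] seta etan smu mun xiP.
have HN := cylinder_atlas HM; have HhA := hat_vbundle HM HA.
have HH : is_lie_algebroid Lhat by case: Hind.
have oT := @openT (cylinder M).
have [f1 [sf1 f1E]] := modular_form_hat HM HA HL Hind setaH etaH0 smuH muH0 xiHP
  seta0 eta00 smu0 mu00 xi'P.
have [f2 [sf2 f2E]] := modular_form_hat HM HA HL Hind setaH etaH0 smuH muH0 xiHP
  seta etan smu mun xiP.
have cxiH := modular_closed HN HhA HH setaH smuH xiHP etaH0 muH0.
(* This is [phi0 = d t]: the time component of the anchor of a time-independent section [X] is
   [<phi0, X>]. *)
have dt p (v : hat A p) :
    phi0 p.1 v = dirder p (anchor Lhat p v) (snd : cylinder M -> R).
  have [X [sX <-]] := section_through HM HA v.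
  exact/esym/(dirder_hat_snd Hind p sX).
pose c : R := n%:R - 1.
(* A primitive of [(n - 1) phi0], the term that separates the Jacobi modular form from [xi']. *)
pose tc : cylinder M -> R := fun p => c * p.2.
have stc : smooth_on setT tc := smooth_mul HN oT (smooth_cst setT c) smooth_snd.
have sxi' : smooth_section xi' by case: xi'P.
have sxi0 : smooth_section (fun x => xi' x - c *: phi0 x).
  have HD := dual_vbundle HM HA; apply: (smooth_section_add HM HD openT sxi').
  have s := smooth_section_scale HM HD openT (smooth_cst setT (- c)) sphi0.
  by apply: (smooth_section_eq openT _ s) => x _; rewrite scaleNr.
have tsxi0 := smooth_time_indep_dual HM HA sxi0.
have E1 p (v : hat A p) : xiH p v - time_indep_dual (fun x => xi' x - c *: phi0 x) p v =
    dirder p (anchor Lhat p v) (fun q => f1 q + tc q).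
  rewrite (dirderD HN (I : setT p) _ sf1 stc) -f1E.
  rewrite (dirderZ HN (I : setT p) _ _ smooth_snd) -dt /time_indep_dual.
  have -> : (xi' p.1 - c *: phi0 p.1 : 'Hom(A p.1, R^o)) v =
      xi' p.1 v - c * phi0 p.1 v by rewrite add_lfunE opp_lfunE scale_lfunE.
  ring.
have sf1t := smooth_add HN oT sf1 stc.
have H1 := cohomologous HN HhA HH cxiH tsxi0 sf1t E1.
(* The cocycle property of the Jacobi form is taken from the first equality. Its difference with
   [xi] is that of [xiH] with [xi] minus that of [xiH] with the Jacobi form, whence the primitive
   below. *)
split=> //; have [_ c0 _] := H1.
have sxi : smooth_section xi by case: xiP.
apply: (cohomologous HN HhA HH c0 (smooth_time_indep_dual HM HA sxi)
  (f := fun p => f2 p - (f1 p + tc p))).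
  exact: (smooth_add HN oT sf2 (smooth_opp HN oT sf1t)).
move=> p v; rewrite (dirderB HN (I : setT p) _ oT sf2 sf1t) -E1 -f2E.
ring.
Qed.
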